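(* Let $d\in\mathbb{N}$, $\lambda>0$, and let $f_{in},f_{out}$ be connection functions in the sparse regime. If the random connection model with connection function $f_{in}-f_{out}$ does not percolate, i.e. $\theta(H_{\lambda,f_{in}(\cdot)-f_{out}(\cdot),d})=0$, then weak recovery is not solvable for $\lambda,d,f_{in},f_{out}$.
   Context: Sparse model: $f_{in},f_{out}:\mathbb{R}_+\to[0,1]$ are measurable with $f_{in}(r)\ge f_{out}(r)$ for all $r\ge 0$ and $0<\int_{\mathbb{R}^d}(f_{in}(\|x\|)+f_{out}(\|x\|))dx<\infty$ ($\|\cdot\|$ Euclidean). Let $\phi=\{X_1,X_2,\dots\}$ be a homogeneous Poisson point process of intensity $\lambda$ on $\mathbb{R}^d$, enumerated so that $\|X_i\|_\infty$ is non-decreasing in $i$. Independently of $\phi$, let $(Z_i)_{i\in\mathbb{N}}$ be i.i.d. uniform on $\{-1,+1\}$ (community labels) and $(U_{ij})_{i<j}$ i.i.d. uniform on $[0,1]$, independent of $(Z_i)$, with $U_{ji}=U_{ij}$. The graph $G$ has vertex set $\mathbb{N}$ and an edge $\{i,j\}$ iff $U_{ij}\le f_{in}(\|X_i-X_j\|)\mathbf{1}_{Z_i=Z_j}+f_{out}(\|X_i-X_j\|)\mathbf{1}_{Z_i\ne Z_j}$. Let $B_n=[-n^{1/d}/2,n^{1/d}/2]^d$, $\phi_n=\phi\cap B_n$ (with the locations attached to the vertices), $N_n=|\phi_n|$, and let $G_n$ be the subgraph of $G$ induced on the vertices located in $B_n$. Weak recovery is solvable for $\lambda,d,f_{in},f_{out}$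 if there are a constant $\gamma>0$ and, for every $n$, $\{-1,+1\}$-valued random variables $(\tau^{(n)}_i)_{i\le N_n}$ which are a deterministic function of $(G_n,\phi_n)$ (the function may depend on the model parameters) such that $\lim_{n\to\infty}\mathbb{P}[\mathcal{O}_n\ge\gamma]=1$, where $\mathcal{O}_n=\frac{1}{N_n}\left|\sum_{i=1}^{N_n}\tau_i^{(n)}Z_i\right|$ is the overlap ($\mathcal{O}_n:=1$ if $N_n=0$). Random connection model: for $g:\mathbb{R}_+\to[0,1]$, $H_{\lambda,g(\cdot),d}$ is the random graph whose vertices form a homogeneous Poisson point process of intensity $\lambda$ on $\mathbb{R}^d$ and where, conditionally on the locations, two points $x,y$ are joined independently with probability $g(\|x-y\|)$. $\theta(H_{\lambda,g(\cdot),d})$ is the probability, after adding an extra vertex at the origin connected to the others by the same independent rule (Palm measure $\mathbb{P}^0$), that the connected component of the origin is infinite. *)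

(* Defs.v *)
From HB Require Import structures.
From mathcomp Require Import all_boot all_order all_algebra finmap.
From mathcomp Require Import all_classical all_reals all_analysis.

Set Implicit Arguments.
Unset Strict Implicit.
Unset Printing Implicit Defensive.

Import Order.TTheory GRing.Theory Num.Theory.
Import numFieldNormedType.Exports.

Local Open Scope classical_set_scope.
Local Open Scope ring_scope.

(* R^d with its Borel sigma-algebra: the library equips tuples with the product
   sigma-algebra. *)
Notation euclidean R d := (d.-tuple (measurableTypeR R)).

Section tuple_lebesgue.
Context {R : realType}.

Definition tuple_cons d (p : measurableTypeR R * euclidean R d) :
  euclidean R d.+1 := [tuple of p.1 :: p.2].

Lemma measurable_tuple_cons d : measurable_fun setT (@tuple_cons d).
Proof. exact: (measurable_cons measurable_fst measurable_snd). Qed.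

Definition tuple_uncons d (t : euclidean R d.+1) :
  measurableTypeR R * euclidean R d :=
  (tnth t ord0, [tuple of behead t]).

Lemma measurable_tuple_uncons d : measurable_fun setT (@tuple_uncons d).
Proof.
by apply/measurable_fun_pair; [exact: measurable_tnth|exact: measurable_behead].
Qed.

Lemma tuple_consK d : cancel (@tuple_cons d) (@tuple_uncons d).
Proof. by case=> x t; congr pair; apply/val_inj. Qed.

Section step.
Context d (m : {sigma_finite_measure set (euclidean R d) -> \bar R}).

Definition tuple_lebesgueS : set (euclidean R d.+1) -> \bar R :=
  pushforward (lebesgue_measure \x m)%E (@tuple_cons d).

Let nu : {measure set (euclidean R d.+1) -> \bar R} :=
  measure_function_pushforward__canonical__measure_function_Measure
    (lebesgue_measure \x m)%E (@measurable_tuple_cons d).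

HB.instance Definition _ := isMeasure.Build _ _ _ tuple_lebesgueS
  (measure0 nu) (measure_ge0 nu) (@measure_semi_sigma_additive _ _ _ nu).

Let sigma_finite_tuple_lebesgueS : sigma_finite setT tuple_lebesgueS.
Proof.
have /sigma_finiteP[F [TF ndF Foo]] := sigma_finiteT (@lebesgue_measure R).
have /sigma_finiteP[G [TG ndG Goo]] := sigma_finiteT m.
exists (fun n => @tuple_uncons d @^-1` (F n `*` G n)).
  rewrite -preimage_bigcup -[LHS](@preimage_setT _ _ (@tuple_uncons d)).
  congr (_ @^-1` _); apply/seteqP; split=> // -[x y] _.
  have [n _ Fnx] : (\bigcup_n F n) x by rewrite -TF.
  have [k _ Gky] : (\bigcup_n G n) y by rewrite -TG.
  exists (maxn n k) => //; split.
  - by move: x Fnx; exact/subsetPset/ndF/leq_maxl.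
  - by move: y Gky; exact/subsetPset/ndG/leq_maxr.
move=> n; have [mF Fn] := Foo n; have [mG Gn] := Goo n; split.
  rewrite -[X in measurable X]setTI.
  by apply: measurable_tuple_uncons => //; exact: measurableX.
rewrite /tuple_lebesgueS /pushforward -comp_preimage.
rewrite (_ : _ \o _ = id) ?preimage_id; last first.
  by apply/funext => x; exact: tuple_consK.
by rewrite product_measure1E// lte_mul_pinfty// ge0_fin_numE.
Qed.

HB.instance Definition _ := @Measure_isSigmaFinite.Build _ _ _ tuple_lebesgueS
  sigma_finite_tuple_lebesgueS.

End step.

Fixpoint tuple_lebesgue d :
    {sigma_finite_measure set (euclidean R d) -> \bar R} :=
  match d return {sigma_finite_measure set (d.-tuple _) -> \bar R} with
  | 0 => \d_([tuple])
  | d'.+1 => tuple_lebesgueS (tuple_lebesgue d')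
  end.

End tuple_lebesgue.

Section geometry.
Context {R : realType} {d : nat}.
Implicit Types x y : euclidean R d.

Definition origin : euclidean R d := [tuple 0 | k < d].

Definition edist x y : R := Num.sqrt (\sum_(k < d) (tnth x k - tnth y k) ^+ 2).

Definition supnorm x : R := \big[Num.max/0]_(k < d) `|tnth x k|.

Definition box (n : nat) : set (euclidean R d) :=
  [set x | forall k, `|tnth x k| <= n%:R `^ d%:R^-1 / 2].

End geometry.

Definition sparse_regime {R : realType} (d : nat) (f_in f_out : R -> R) : Prop :=
  [/\ measurable_fun [set r : R | 0 <= r] f_in,
      measurable_fun [set r : R | 0 <= r] f_out,
      forall r, 0 <= r -> [/\ 0 <= f_in r <= 1, 0 <= f_out r <= 1 &
                             f_out r <= f_in r],
      (0 < \int[tuple_lebesgue d]_x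
             (f_in (edist x origin) + f_out (edist x origin))%:E)%E &
      (\int[tuple_lebesgue d]_x
             (f_in (edist x origin) + f_out (edist x origin))%:E < +oo)%E].

Section probability_notions.
Context {R : realType} {dT : measure_display} {T : measurableType dT}.
Variable P : probability T R.

Definition sigma_rv d' (E : measurableType d') (Y : T -> E) : set (set T) :=
  preimage_set_system setT Y measurable.

Definition sigma_seq d' (E : measurableType d') (Y : nat -> T -> E) :
    set (set T) :=
  <<s \bigcup_i sigma_rv (Y i) >>.

Definition mutually_independent (I : eqType) (D : set I)
    (F : I -> set (set T)) : Prop :=
  forall (s : seq I) (E : I -> set T), uniq s ->
    (forall i, i \in s -> D i /\ F i (E i)) ->
    P (\bigcap_(i in [set` s]) E i) = (\prod_(i <- s) P (E i))%E.

(* The point process is the multiset {X i | i : nat}; its counts in disjoint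
   Borel sets of finite volume are independent Poisson variables. The second
   argument of poisson_prob is irrelevant in the library's definition, and the
   law degenerates to the Dirac mass at 0 when the volume is 0. *)
Definition poisson_process d (lambda : R) (X : nat -> {RV P >-> euclidean R d}) :
    Prop :=
  forall (m : nat) (A : 'I_m -> set (euclidean R d)) (k : 'I_m -> nat),
    (forall j, measurable (A j)) -> trivIset setT A ->
    (forall j, (tuple_lebesgue d (A j) < +oo)%E) ->
    P [set w | forall j,
         counting [set i | A j (X i w)] = (k j)%:R%:E :> \bar R] =
    (\prod_(j < m)
       poisson_prob (lambda * fine (tuple_lebesgue d (A j))) (k j) [set k j])%E.

(* Conditionally on the locations W, the edges between distinct vertices are
   independent and {i, j} is present with probability g of the distance. *)
Definition connection_model d (g : R -> R) (W : nat -> T -> euclidean R d)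
    (e : nat -> nat -> {RV P >-> bool}) : Prop :=
  [/\ forall i w, e i i w = false,
      forall i j w, e i j w = e j i w &
      forall (A : set T) (s : seq (nat * nat)) (b : nat * nat -> bool),
        sigma_seq W A -> uniq s -> all (fun p => p.1 < p.2)%N s ->
        P (A `&` [set w | forall p, p \in s -> e p.1 p.2 w = b p]) =
        (\int[P]_(w in A)
          (\prod_(p <- s) let q := g (edist (W p.1 w) (W p.2 w)) in
                          if b p then q else 1 - q)%:E)%E].

(* Vertex 0 is the vertex added at the origin; vertex i.+1 is located at the
   i-th point of the process. *)
Definition palm_locations d (Y : nat -> T -> euclidean R d) (i : nat) (w : T) :
    euclidean R d :=
  if i is i'.+1 then Y i' w else origin.

Definition palm_rcm d (lambda : R) (g : R -> R)
    (Y : nat -> {RV P >-> euclidean R d}) (e : nat -> nat -> {RV P >-> bool}) :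
    Prop :=
  poisson_process lambda Y /\ connection_model g (palm_locations Y) e.

Definition component (e : rel nat) (i : nat) : set nat :=
  [set j | exists p, path e i p /\ last i p = j].

Definition percolation_probability (e : nat -> nat -> {RV P >-> bool}) : \bar R :=
  P [set w | infinite_set (component (fun i j => e i j w) 0)].

End probability_notions.

Section block_model.
Context {R : realType} {dT : measure_display} {T : measurableType dT}.
Variables (P : probability T R) (d : nat) (lambda : R) (f_in f_out : R -> R).
Variables (X : nat -> {RV P >-> euclidean R d}) (Z : nat -> {RV P >-> bool})
  (U : nat -> nat -> {RV P >-> R}).

(* Independent sources of randomness: the whole point process, each label, and
   each mark. *)
Definition sbm_source (s : option (nat + nat * nat)) : set (set T) :=
  match s with
  | None => sigma_seq X
  | Some (inl i) => sigma_rv (Z i)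
  | Some (inr (i, j)) => sigma_rv (U i j)
  end.

(* Labels are booleans, true standing for +1 and false for -1. *)
Definition block_model : Prop :=
  [/\ [/\ poisson_process lambda X &
          forall i j w, (i <= j)%N -> supnorm (X i w) <= supnorm (X j w)],
      forall i b, P (Z i @^-1` [set b]) = (2^-1)%:E,
      (forall i j w, U i j w = U j i w) /\
      (forall i j A, (i < j)%N -> measurable A ->
         distribution P (U i j) A = uniform_prob (@ltr01 R) A) &
      mutually_independent P
        [set s | if s is Some (inr (i, j)) then (i < j)%N : Prop else True]
        sbm_source].

Definition spin (b : bool) : R := if b then 1 else -1.

Definition sbm_edge (i j : nat) (w : T) : bool :=
  (i != j) &&
  let r := edist (X i w) (X j w) in
  (U i j w <= if Z i w == Z j w then f_in r else f_out r).

(* fset_set sends infinite sets, hence here only an event of probability 0, to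
   the empty set. *)
Definition box_size (n : nat) (w : T) : nat :=
  #|` fset_set [set i | box n (X i w)]|%fset.

(* Since supnorm (X i w) is nondecreasing in i and box n is a ball for supnorm,
   the vertices located in box n are the i < box_size n. *)
Definition observation (m : nat) (w : T) :
    m.-tuple (euclidean R d) * m.-tuple (m.-tuple bool) :=
  ([tuple X i w | i < m], [tuple [tuple sbm_edge i j w | j < m] | i < m]).

(* Measurability of the deterministic functions is what makes the estimates
   random variables that carry no more information than the observation. *)
Definition estimator : Type :=
  forall m : nat,
    {mfun (m.-tuple (euclidean R d) * m.-tuple (m.-tuple bool))%type >->
          m.-tuple bool}.

Definition overlap (h : estimator) (n : nat) (w : T) : R :=
  let m := box_size n w in
  if m == 0%N then 1 else
  `|\sum_(i < m) spin (tnth (h m (observation m w)) i) * spin (Z i w)| / m%:R.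

Definition weak_recovery_solvable : Prop :=
  exists2 gamma : R, 0 < gamma & exists h : nat -> estimator,
    (fun n => P [set w | gamma <= overlap (h n) n w]) @ \oo --> 1%E.

End block_model.

(* Main.v *)
From Pilot Require Import Defs.
From HB Require Import structures.
From mathcomp Require Import all_boot all_order all_algebra finmap.
From mathcomp Require Import all_classical all_reals all_analysis.
From mathcomp Require Import fingroup perm measurable_realfun ring lra.
Import Pilot.Defs.
Import Order.TTheory GRing.Theory Num.Theory.
Import numFieldNormedType.Exports.
Set Implicit Arguments.
Unset Strict Implicit.
Unset Printing Implicit Defensive.
Local Open Scope classical_set_scope.
Local Open Scope ring_scope.

(** Call a pair {i, j} informative when f_out(r) < U_ij <= f_in(r), where r is
    the distance of its endpoints. Any other pair is an edge or a non-edge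
    whatever the labels are, and an informative pair is an edge exactly when its
    two labels agree. Flipping all the labels in one cluster of the informative
    graph therefore leaves the observation unchanged: given locations and marks,
    the relative signs of distinct clusters are invisible to the observer. When
    sum_i tau_i Z_i is squared and averaged over the labels, the products that
    involve two clusters cancel, and the second moment is at most the number of
    pairs of vertices in a common cluster (cluster_second_moment,
    overlap_bound).

    The informative graph is the random connection model with function
    f_in - f_out (informative_law). A vertex of the box lies in a cluster of
    fewer than K vertices or is bad. By Mecke's formula, the expected number of
    bad vertices in the box of volume n is at most lambda n p_K, where p_K is the
    Palm probability that the cluster of the origin has at least K vertices
    (cluster_mecke_bound, palm_size_total); as there is no percolation, p_K
    tends to 0 as K grows (cluster_atleast_small). Put L = lambda n, the expected
    number of points of the box, and let M be about L / 2. If the box has at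
    least M points, Chebyshev's inequality bounds the probability of an overlap
    at least gamma by (K + L p_K) / (gamma^2 M). The box has fewer than M points
    with probability at most 1/2, because a Poisson weight is at most half the
    next one in that range (small_box_counts). Hence the probability of an
    overlap at least gamma does not exceed 3/4 for large n
    (overlap_probability_bound), and it cannot tend to 1.

    The block model and the Palm model live on different probability spaces,
    and a Poisson process is specified by its counts in Borel sets only. Mecke's
    formula is therefore derived from counts (mecke_transfer). For a fixed
    number of points both sides are measures on tuples of points. The
    events that depend only on the colors of the points, for some finite
    measurable coloring of space, are stable under intersection and generate the
    Borel sets (measure_eq_colors). Summed over all orders of the points, the
    event that the tuple of colors is u sees only how many points have each color
    (sum_perm_colors); these numbers are independent Poisson variables, and the
    formula reduces to the identity k q_k = mu q_(k-1) between Poisson weights of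
    mean mu, for the color of the distinguished point (poisson_prob_succ,
    mecke_colors). *)

(** * Flipping labels, and counting orderings of colors *)

Section label_flips.
Context {R : realType} (m : nat) (I : rel 'I_m).
Implicit Types z : {ffun 'I_m -> bool}.

Definition flip_cluster i z : {ffun 'I_m -> bool} :=
  [ffun j => z j (+) connect I i j].

Lemma flip_clusterK i : involutive (flip_cluster i).
Proof. by move=> z; apply/ffunP => j; rewrite !ffunE addbK. Qed.

Lemma spinM_le1 (a b : bool) : spin a * spin b <= 1 :> R.
Proof. by case: a; case: b; rewrite /spin; lra. Qed.

(** Flipping the cluster of i is a measure preserving involution of the
    labellings. It changes the sign of the term (i, j) of the square when j is
    outside that cluster, since tau does not see the flip; such a term averages
    to 0. The remaining terms are at most 1. *)
Lemma cluster_second_moment (tau : {ffun 'I_m -> bool} -> 'I_m -> bool) :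
  (forall z i, tau (flip_cluster i z) = tau z) ->
  \sum_z (\sum_i spin (tau z i) * spin (z i)) ^+ 2 <=
    (2 ^ m)%:R * \sum_i #|connect I i|%:R :> R.
Proof.
move=> tauE.
pose t z i j : R := (spin (tau z i) * spin (z i)) * (spin (tau z j) * spin (z j)).
have -> : \sum_z (\sum_i spin (tau z i) * spin (z i)) ^+ 2 =
          \sum_i \sum_j \sum_z t z i j.
  rewrite (eq_bigr (fun z => \sum_i \sum_j t z i j)); last first.
    move=> z _; rewrite expr2 mulr_suml; apply: eq_bigr => i _.
    by rewrite mulr_sumr.
  by rewrite exchange_big; apply: eq_bigr => i _; rewrite exchange_big.
rewrite mulr_sumr; apply: ler_sum => i _.
rewrite -sum1_card natr_sum mulr_sumr [leRHS]big_mkcond/=.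
apply: ler_sum => j _; rewrite inE; case: ifPn => [_|ij].
  rewrite mulr1; apply: (@le_trans _ _ (\sum_(z : {ffun 'I_m -> bool}) 1)).
    apply: ler_sum => z _; rewrite /t mulrACA -[leRHS]mulr1.
    have := @spinM_le1 (tau z i == tau z j) (z i == z j).
    by rewrite /spin; case: (tau z i) (tau z j) (z i) (z j) => [] [] [] [] /=; lra.
  by rewrite sumr_const card_ffun card_bool card_ord.
suff : \sum_z t z i j = - \sum_z t z i j by move=> h; lra.
rewrite {1}(reindex_inj (inv_inj (flip_clusterK i))) /= -sumrN.
apply: eq_bigr => z _; rewrite /t tauE !ffunE connect0 (negbTE ij) addbF addbT.
by rewrite /spin; case: (z i); case: (z j); rewrite /=; ring.
Qed.

(** A cluster with fewer than K vertices contributes at most K for each of its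
    vertices, and any cluster at most m; the second, wasteful bound is affordable
    because the vertices in large clusters will be rare. *)
Lemma sum_cluster_sizes K :
  \sum_i #|connect I i|%:R <=
    (K * m)%:R + m%:R * \sum_(i < m) (K <= #|connect I i|)%N%:R :> R.
Proof.
rewrite natrM mulrC -[m%:R in X in X + _]mulr1.
have -> : m%:R * 1 * K%:R = \sum_(i < m) K%:R :> R.
  by rewrite sumr_const card_ord mulr1 mulr_natl.
rewrite mulr_sumr -big_split; apply: ler_sum => i _ /=.
case: leqP => [_|/ltnW Ki]; last by rewrite mulr0 addr0 ler_nat.
by rewrite mulr1 -natrD ler_nat (leq_trans (max_card _)) // card_ord leq_addl.
Qed.

End label_flips.

Lemma perm_eq_permute (I : eqType) k (t : k.-tuple I) (s : 'S_k) :
  perm_eq [tuple tnth t (s a) | a < k] t.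
Proof. by apply/tuple_permP; exists s. Qed.

(** The orders of t that give exactly u form a coset of the stabilizer of u when
    t is a reordering of u. Their number does not depend on t, so that summing
    over orders reduces a condition on a tuple of colors to one on a multiset. *)
Lemma sum_perm_colors (I : eqType) k (t u : k.-tuple I) :
  (\sum_(s : 'S_k) ([tuple tnth t (s a) | a < k] == u) =
   \sum_(s : 'S_k) ([tuple tnth u (s a) | a < k] == u) * perm_eq t u)%N.
Proof.
case: (boolP (perm_eq t u)) => [/tuple_permP[p /val_inj tE]|ntu]; last first.
  rewrite [RHS]big1 => [|s _]; last by rewrite muln0.
  rewrite big1// => s _; apply/eqP; rewrite eqb0; apply: contra ntu => /eqP <-.
  by rewrite perm_sym perm_eq_permute.
under [RHS]eq_bigr do rewrite muln1.
rewrite [RHS](reindex_inj (mulIg p)); apply: eq_bigr => s _.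
congr (nat_of_bool (_ == u)); apply: eq_from_tnth => a.
by rewrite tE !tnth_mktuple permM.
Qed.

(** * Countable sums of measures, and laws of tuples on an event *)

Section countable_sum_of_measures.
Context d (T : measurableType d) (R : realType) (J : countType).
Variable mu : J -> {measure set T -> \bar R}.
Local Open Scope ereal_scope.

(** The index j is taken at the single time pickle j: pickle_inv rejects the
    other codes that unpickle would send to j, which would count it again. *)
Definition countable_msum : set T -> \bar R :=
  mseries (fun n => oapp mu mzero (pickle_inv n)) 0.

HB.instance Definition _ := Measure.on countable_msum.

Lemma nneseries_pickle (a : J -> \bar R) : (forall j, 0 <= a j) ->
  \sum_(n <oo) oapp a 0 (pickle_inv n) = \esum_(j in setT) a j.
Proof.
move=> a0; rewrite nneseries_esumT; last by move=> n; case: pickle_inv => /=.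
rewrite (esumID (choice.pickle @` [set: J])); last first.
  by move=> n _; case: pickle_inv => /=.
rewrite setTI [X in _ + X]esum1 ?adde0; last first.
  move=> n [_ nj]; have := @choice.pickle_invK J n.
case: (choice.pickle_inv n) => [j|] //= jn; exfalso; apply: nj.
  by exists j.
rewrite esum_image; last by move=> i j _ _; exact: (pcan_inj choice.pickleK).
by apply: eq_esum => j _; rewrite choice.pickleK_inv.
Qed.

Lemma countable_msumE A : countable_msum A = \esum_(j in setT) mu j A.
Proof.
rewrite -nneseries_pickle => [|j]; last exact: measure_ge0.
by apply: eq_eseriesr => n _; case: pickle_inv.
Qed.

Lemma integral_countable_msum (f : T -> \bar R) :
  (forall t, 0 <= f t) -> measurable_fun setT f ->
  \int[countable_msum]_t f t = \esum_(j in setT) \int[mu j]_t f t.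
Proof.
move=> f0 mf; rewrite -nneseries_pickle => [|j]; last exact: integral_ge0.
rewrite ge0_integral_measure_series//.
by apply: eq_eseriesr => n _; case: pickle_inv => //=; rewrite integral_measure_zero.
Qed.

End countable_sum_of_measures.

Section law_on_event.
Context d d' (T : measurableType d) (E : measurableType d') (R : realType).
Variables (mu : {measure set T -> \bar R}) (D : set T) (V : T -> E).
Local Open Scope ereal_scope.

(** The law of V restricted to the event D, of total mass mu D. It lets one
    treat the event that a window contains prescribed points, and the tuple of
    these points, as a single measure. *)
Definition law_on of measurable D & measurable_fun setT V : set E -> \bar R :=
  fun C => mu (D `&` V @^-1` C).

Hypotheses (mD : measurable D) (mV : measurable_fun setT V).

Let mVC C : measurable C -> measurable (V @^-1` C).
Proof. by move=> mC; rewrite -[X in measurable X]setTI; exact: mV. Qed.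

Let law_on0 : law_on mD mV set0 = 0.
Proof. by rewrite /law_on preimage_set0 setI0 measure0. Qed.

Let law_on_ge0 C : 0 <= law_on mD mV C. Proof. exact: measure_ge0. Qed.

Let law_on_sigma_additive : semi_sigma_additive (law_on mD mV).
Proof.
move=> F mF tF mUF; rewrite /law_on preimage_bigcup setI_bigcupr.
apply: measure_semi_sigma_additive.
- by move=> n; apply: measurableI => //; exact: mVC.
- apply/trivIsetP => i j _ _ ij; rewrite setIACA -(preimage_setI V).
  by move/trivIsetP : tF => ->//; rewrite preimage_set0 setI0.
- by rewrite -setI_bigcupr -preimage_bigcup; apply: measurableI => //; exact: mVC.
Qed.

HB.instance Definition _ := isMeasure.Build _ _ _ (law_on mD mV)
  law_on0 law_on_ge0 law_on_sigma_additive.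

Lemma integral_law_on (f : E -> \bar R) :
  (forall t, 0 <= f t) -> measurable_fun setT f ->
  \int[law_on mD mV]_t f t = \int[mu]_(w in D) f (V w).
Proof.
move=> f0 mf.
have -> : \int[law_on mD mV]_t f t =
    \int[measure_function_pushforward__canonical__measure_function_Measure
           (mrestr mu mD) mV]_t f t.
  apply: eq_measure_integral => C mC _.
  by rewrite /= /law_on /pushforward /mrestr setIC.
rewrite ge0_integral_pushforward//= preimage_setT.
(* The measure mrestr mu mD does not charge the complement of D. *)
rewrite [LHS](ge0_negligible_integral (N := ~` D))//=; first last.
- by rewrite /mrestr setICl measure0.
- exact: measurableT_comp.
- exact: measurableC.
rewrite setTD setCK; apply: eq_measure_integral => C mC CD.
by rewrite /= /mrestr setIidl.
Qed.

End law_on_event.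

(** * A measure on tuples is determined by finite colorings *)

Section colorings.
Context d (E : measurableType d) (R : realType) (m : nat).

Definition coloring (I : Type) (c : E -> I) : Prop :=
  forall i, measurable (c @^-1` [set i]).

Definition color_event (I : finType) (c : E -> I) (Q : pred (m.-tuple I)) :
  set (m.-tuple E) := [set t | Q (map_tuple c t)].

Definition color_events : set (set (m.-tuple E)) :=
  [set S | exists (I : finType) (c : E -> I) (Q : pred (m.-tuple I)),
     coloring c /\ S = color_event c Q].

(** Two colorings have a common refinement, their product. *)
Lemma setI_closed_color_events : setI_closed color_events.
Proof.
move=> _ _ [I1 [c1 [Q1 [mc1 ->]]]] [I2 [c2 [Q2 [mc2 ->]]]].
exists (I1 * I2)%type, (fun x => (c1 x, c2 x)).
exists (fun u => Q1 (map_tuple fst u) && Q2 (map_tuple snd u)); split.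
  move=> [i1 i2].
  have -> : (fun x => (c1 x, c2 x)) @^-1` [set (i1, i2)] =
            c1 @^-1` [set i1] `&` c2 @^-1` [set i2].
    by apply/seteqP; split => x /= => [[-> ->]|[-> ->]].
  by apply: measurableI; [exact: mc1|exact: mc2].
apply/seteqP; split => t; rewrite /color_event /=.
  move=> [Q1t Q2t]; apply/andP; split.
    by rewrite (_ : map_tuple _ _ = map_tuple c1 t)//; apply/val_inj; rewrite /= -map_comp.
  by rewrite (_ : map_tuple _ _ = map_tuple c2 t)//; apply/val_inj; rewrite /= -map_comp.
move=> /andP[Q1t Q2t]; split.
  by move: Q1t; rewrite (_ : map_tuple _ _ = map_tuple c1 t)//; apply/val_inj; rewrite /= -map_comp.
by move: Q2t; rewrite (_ : map_tuple _ _ = map_tuple c2 t)//; apply/val_inj; rewrite /= -map_comp.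
Qed.

Lemma color_event_bigcup (I : finType) (c : E -> I) (Q : pred (m.-tuple I)) :
  color_event c Q =
    \bigcup_(u in [set u | Q u]) [set t | map_tuple c t = u].
Proof.
apply/seteqP; split => t; rewrite /color_event/=; last by move=> [u Qu] ->.
by move=> Qt; exists (map_tuple c t).
Qed.

Lemma measurable_color_fiber d' (T : measurableType d') (I : eqType) (c : E -> I)
    (V : T -> m.-tuple E) (u : m.-tuple I) :
  coloring c -> measurable_fun setT V ->
  measurable [set w | map_tuple c (V w) = u].
Proof.
move=> mc /measurable_fun_tnthP mV.
have -> : [set w | map_tuple c (V w) = u] =
    \bigcap_(a in [set: 'I_m]) ((fun w => tnth (V w) a) @^-1` (c @^-1` [set tnth u a])).
  apply/seteqP; split => w /=; first by move=> H a _ /=; rewrite -H tnth_map.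
  by move=> H; apply: eq_from_tnth => a; rewrite tnth_map; exact: H.
apply: fin_bigcap_measurable => // a _.
by rewrite -[X in measurable X]setTI; apply: mV => //; exact: mc.
Qed.

(** Colorings with two colors, A and its complement, already give the preimages
    of Borel sets by the coordinates. *)
Lemma measurable_color_events : measurable = <<s color_events >>.
Proof.
apply/seteqP; split => S.
  have mid : measurable_fun setT
      (idfun : g_sigma_algebraType color_events -> m.-tuple E).
    apply/measurable_fun_tnthP => a _ A mA; rewrite setTI.
    apply: sub_sigma_algebra.
    exists bool, (fun x => x \in A), (fun u => tnth u a); split.
      move=> b; have -> : (fun x => x \in A) @^-1` [set b] = if b then A else ~` A.
        apply/seteqP; case: b; split => x /=; [exact: set_mem|exact: mem_set| |exact: memNset].
        by move=> xA /mem_set; rewrite xA.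
      by case: b => //; exact: measurableC.
    by apply/seteqP; split => t; rewrite /color_event/= tnth_map; [exact: mem_set|exact: set_mem].
  by move=> mS; have := mid measurableT S mS; rewrite setTI.
apply: smallest_sub => [|_ [I [c [Q [mc ->]]]]]; first exact: sigma_algebra_measurable.
rewrite color_event_bigcup; apply: fin_bigcup_measurable => // u _.
exact: (@measurable_color_fiber _ _ _ c id).
Qed.

(** Uniqueness of measures on a generating pi-system. The total mass is itself
    the mass of a color event, for the coloring with one color. *)
Lemma measure_eq_colors (nu1 nu2 : {measure set (m.-tuple E) -> \bar R}) :
  (nu1 setT < +oo)%E ->
  (forall (I : finType) (c : E -> I) (u : m.-tuple I), coloring c ->
    nu1 [set t | map_tuple c t = u] = nu2 [set t | map_tuple c t = u]) ->
  forall A, measurable A -> nu1 A = nu2 A.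
Proof.
move=> nu1oo nu12; apply: (measure_unique color_events (fun=> setT)) => //.
- exact: measurable_color_events.
- exact: setI_closed_color_events.
- move=> _; exists unit, (fun=> tt), xpredT; split => //.
  by move=> u; rewrite (_ : _ @^-1` _ = setT)//; apply/seteqP; split => // x _; case: u.
  by apply/seteqP; split.
- by rewrite predeqE => x; split => // _; exists 0%N.
- move=> _ [I [c [Q [mc ->]]]]; rewrite color_event_bigcup.
  have mF (u : m.-tuple I) : measurable [set t : m.-tuple E | map_tuple c t = u].
    exact: (@measurable_color_fiber _ (m.-tuple E) I c id u mc (@measurable_id _ _ _)).
  have tF : trivIset [set u | Q u] (fun u => [set t | map_tuple c t = u]).
    by apply/trivIsetP => u v _ _ uv; rewrite -subset0 => t /= [tu tv];
       move: uv; rewrite -tu -tv eqxx.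
  have fQ : finite_set [set u | Q u] by exact: finite_finset.
  rewrite !measure_fin_bigcup//.
  by apply: eq_fsbigr => u _; exact: nu12.
Qed.

End colorings.

Section transfer.
Context d (E : measurableType d) (R : realType) (m : nat).
Context d1 (T1 : measurableType d1) d2 (T2 : measurableType d2).
Context (mu1 : {measure set T1 -> \bar R}) (mu2 : {measure set T2 -> \bar R}).
Context (J1 J2 : countType).
Context (D1 : J1 -> set T1) (V1 : J1 -> T1 -> m.-tuple E).
Context (D2 : J2 -> set T2) (V2 : J2 -> T2 -> m.-tuple E).
Hypotheses (mD1 : forall j, measurable (D1 j)) (mD2 : forall j, measurable (D2 j)).
Hypotheses (mV1 : forall j, measurable_fun setT (V1 j))
           (mV2 : forall j, measurable_fun setT (V2 j)).
Local Open Scope ereal_scope.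

(** Two families of random tuples, on spaces that need not be related, have the
    same total intensity as soon as they give the same masses to color tuples.
    This is how two realizations of a Poisson process, of which only counts are
    known, are compared. *)
Lemma transfer_by_colors :
  \esum_(j in setT) mu1 (D1 j) < +oo ->
  (forall (I : finType) (c : E -> I) (u : m.-tuple I), coloring c ->
    \esum_(j in setT) mu1 (D1 j `&` [set w | map_tuple c (V1 j w) = u]) =
    \esum_(j in setT) mu2 (D2 j `&` [set w | map_tuple c (V2 j w) = u])) ->
  forall f : m.-tuple E -> \bar R, (forall t, 0 <= f t) -> measurable_fun setT f ->
  \esum_(j in setT) \int[mu1]_(w in D1 j) f (V1 j w) =
  \esum_(j in setT) \int[mu2]_(w in D2 j) f (V2 j w).
Proof.
move=> fin H f f0 mf.
pose nu1 : {measure set (m.-tuple E) -> \bar R} :=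
  countable_msum (fun j => law_on mu1 (mD1 j) (mV1 j)).
pose nu2 : {measure set (m.-tuple E) -> \bar R} :=
  countable_msum (fun j => law_on mu2 (mD2 j) (mV2 j)).
transitivity (\int[nu1]_t f t).
  rewrite integral_countable_msum//; apply: eq_esum => j _.
  by rewrite integral_law_on.
transitivity (\int[nu2]_t f t); last first.
  rewrite integral_countable_msum//; apply: eq_esum => j _.
  by rewrite integral_law_on.
apply: eq_measure_integral => A mA _; apply: measure_eq_colors => //.
  rewrite /nu1/= countable_msumE; apply: le_lt_trans fin; apply: le_esum => j _.
  by rewrite /= /law_on preimage_setT setIT.
by move=> I c u mc; rewrite /= !countable_msumE; exact: H.
Qed.

End transfer.

(** * Volumes and translations in Euclidean space *)

Section euclidean_geometry.
Context {R : realType}.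
Implicit Types d : nat.

Definition shift d (v x : euclidean R d) : euclidean R d :=
  [tuple tnth v k + tnth x k | k < d].

Lemma measurable_shift2 d (d' : measure_display) (T : measurableType d')
    (V W : T -> euclidean R d) :
  measurable_fun setT V -> measurable_fun setT W ->
  measurable_fun setT (fun w => shift (V w) (W w)).
Proof.
move=> /measurable_fun_tnthP mV /measurable_fun_tnthP mW.
apply/measurable_fun_tnthP => k.
rewrite (_ : _ \o _ = fun w => tnth (V w) k + tnth (W w) k); last first.
  by apply/funext => w; rewrite /= tnth_mktuple.
by apply: measurable_funD; [exact: mV|exact: mW].
Qed.

Lemma measurable_shift d (v : euclidean R d) : measurable_fun setT (shift v).
Proof. exact: measurable_shift2. Qed.

Lemma edist_shift d (v x y : euclidean R d) : edist (shift v x) (shift v y) = edist x y.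
Proof.
rewrite /edist; congr Num.sqrt; apply: eq_bigr => k _.
by rewrite !tnth_mktuple; congr (_ ^+ 2); ring.
Qed.

Lemma edist_sym d (x y : euclidean R d) : edist x y = edist y x.
Proof.
rewrite /edist; congr Num.sqrt; apply: eq_bigr => k _.
by rewrite -sqrrN opprB.
Qed.

Lemma edist_ge0 d (x y : euclidean R d) : 0 <= edist x y.
Proof. exact: sqrtr_ge0. Qed.

Lemma shift_origin d (v : euclidean R d) : shift v origin = v.
Proof. by apply: eq_from_tnth => k; rewrite !tnth_mktuple addr0. Qed.

Lemma origin_shift d (v : euclidean R d) : shift origin v = v.
Proof. by apply: eq_from_tnth => k; rewrite !tnth_mktuple add0r. Qed.

Lemma measurable_edist d (d' : measure_display) (T : measurableType d')
    (V W : T -> euclidean R d) :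
  measurable_fun setT V -> measurable_fun setT W ->
  measurable_fun setT (fun w => edist (V w) (W w)).
Proof.
move=> /measurable_fun_tnthP mV /measurable_fun_tnthP mW.
have msqrt : measurable_fun setT (@Num.sqrt R) := continuous_measurable_fun (@sqrt_continuous R).
apply: (measurableT_comp msqrt).
apply: measurable_sum => k; apply: measurable_funX.
by apply: measurable_funB; [exact: mV|exact: mW].
Qed.

Lemma lebesgue_translation (v : R) (A : set (measurableTypeR R)) : measurable A ->
  lebesgue_measure [set x | A (v + x)] = lebesgue_measure A.
Proof.
move=> mA.
have mv : measurable_fun setT (fun x : measurableTypeR R => v + x : measurableTypeR R).
  exact: measurable_funD.
symmetry.
apply: (lebesgue_measure_unique
 (mu := measure_function_pushforward__canonical__measure_function_Measure
    lebesgue_measure mv)) => // _ [[a b] _ <-] /=.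
rewrite /pushforward (_ : _ @^-1` _ = `]a - v, b - v]%classic); last first.
  by apply/seteqP; split => x /=; rewrite !in_itv/= ltrBlDl lerBrDl.
by rewrite !lebesgue_measure_itv/= !lte_fin ltrD2r; case: ifPn => // _; congr (_%:E); ring.
Qed.

(** By induction on the dimension: uniqueness of the product measure reduces the
    translation of a product set to the translations of its two factors. *)
Lemma tuple_lebesgue_translation d (v : euclidean R d) (A : set (euclidean R d)) :
  measurable A -> tuple_lebesgue d [set x | A (shift v x)] = tuple_lebesgue d A.
Proof.
elim: d v A => [|d IH] v A mA.
  congr (tuple_lebesgue 0 _); apply/seteqP; split => x /=;
    by rewrite [shift v x]tuple0 [x]tuple0.
rewrite /= /tuple_lebesgueS /pushforward.
pose sh (p : measurableTypeR R * euclidean R d) : measurableTypeR R * euclidean R d :=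
  (tnth v ord0 + p.1, shift [tuple of behead v] p.2).
have msh : measurable_fun setT sh.
  apply/measurable_fun_pair; first by apply: measurable_funD => //.
  by apply: measurable_shift2 => //.
have mcons (B : set (euclidean R d.+1)) : measurable B -> measurable (@tuple_cons R d @^-1` B).
  by move=> mB; rewrite -[X in measurable X]setTI; exact: measurable_tuple_cons.
rewrite [RHS](product_measure_unique
 (m' := measure_function_pushforward__canonical__measure_function_Measure
    (lebesgue_measure \x tuple_lebesgue d)%E msh)) //; first last.
- exact: mcons.
- move=> B C mB mC; rewrite /= /pushforward.
  rewrite (_ : _ @^-1` _ = [set x | B (tnth v ord0 + x)] `*`
    [set x | C (shift [tuple of behead v] x)])//.
  have mB' : measurable [set x : measurableTypeR R | B (tnth v ord0 + x)].
    have mtr : measurable_fun setT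
        (fun x : measurableTypeR R => tnth v ord0 + x : measurableTypeR R).
      exact: measurable_funD.
    by have := mtr measurableT B mB; rewrite setTI.
  have mC' : measurable [set x | C (shift [tuple of behead v] x)].
    by have := @measurable_shift d [tuple of behead v] measurableT C mC; rewrite setTI.
  by rewrite product_measure1E//; congr (_ * _)%E; [exact: lebesgue_translation|exact: IH].
have shE p : shift v (tuple_cons p) = tuple_cons (sh p).
  case: p => x t; apply: eq_from_tnth => k; rewrite tnth_mktuple /tuple_cons/=.
  case: (unliftP ord0 k) => [j ->|->]; last by rewrite !tnth0.
  by rewrite !tnthS tnth_mktuple tnth_behead; congr (tnth v _ + _);
    apply/val_inj; rewrite /= inordK// ltnS.
by rewrite /= /pushforward; congr (_ _); apply/seteqP; split => p /=; rewrite shE.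
Qed.

Definition cube d (a : R) : set (euclidean R d) := [set x | forall k, `|tnth x k| <= a].

Lemma measurable_cube d a : measurable (@cube d a).
Proof.
rewrite (_ : @cube d a =
    \bigcap_(k in [set: 'I_d]) ((fun x => tnth x k) @^-1` [set r | `|r| <= a])); last first.
  by apply/seteqP; split => x /= h k; [move=> _|]; exact: h.
apply: fin_bigcap_measurable => // k _.
rewrite -[X in measurable X]setTI; apply: measurable_tnth => //.
rewrite (_ : [set r | _] = `[-a, a]%classic); first exact: measurable_itv.
by apply/seteqP; split => r /=; rewrite in_itv/= ler_norml.
Qed.

Lemma volume_cube d a : 0 <= a -> tuple_lebesgue d (@cube d a) = ((2 * a) ^+ d)%:E.
Proof.
move=> a0; elim: d => [|d IH].
  rewrite /= (_ : @cube 0 a = setT) ?expr0 ?diracT//.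
  by apply/seteqP; split => // x _ [].
rewrite /= /tuple_lebesgueS /pushforward.
rewrite (_ : _ @^-1` _ = `[-a, a]%classic `*` @cube d a); last first.
  apply/seteqP; split => -[x t] /=.
    move=> h; split; first by have := h ord0; rewrite in_itv/= ler_norml.
    by move=> k; have := h (lift ord0 k); rewrite tnthS.
  move=> [xa ta] k; case: (unliftP ord0 k) => [j ->|->]; first by rewrite tnthS; exact: ta.
  by move: xa; rewrite in_itv/= ler_norml.
rewrite product_measure1E//; last exact: measurable_cube.
rewrite IH [X in (X * _)%E]lebesgue_measure_itv/= lte_fin exprS.
case: ifPn => [_|]; first by rewrite -EFinB -EFinM; congr ((_ * _)%:E); ring.
rewrite -leNgt => aNa; have -> : a = 0 by lra.
by rewrite mul0e mulr0 mul0r.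
Qed.

Lemma box_cube d n : @box R d n = @cube d (n%:R `^ d%:R^-1 / 2).
Proof. by []. Qed.

(** In dimension 0 the space is a single point of mass 1, whatever n is. *)
Lemma volume_box d n : (0 < d)%N -> tuple_lebesgue d (@box R d n) = n%:R%:E.
Proof.
move=> d0; rewrite box_cube volume_cube; last by rewrite divr_ge0 ?powR_ge0.
rewrite mulrC divfK// -powR_mulrn ?powR_ge0// -powRrM mulVf ?powRr1//.
by rewrite pnatr_eq0 -lt0n.
Qed.

Lemma measurable_box d n : measurable (@box R d n).
Proof. exact: measurable_cube. Qed.

(** A box is a ball of the norm by which the points are enumerated, hence the
    points in it form an initial segment of the enumeration. *)
Lemma box_supnorm d n (x : euclidean R d) :
  box n x <-> supnorm x <= n%:R `^ d%:R^-1 / 2.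
Proof.
rewrite /box /supnorm /=; split => [h|h k].
  by apply/bigmax_leP; split => //; rewrite divr_ge0 ?powR_ge0.
by apply: le_trans h; exact: le_bigmax.
Qed.

End euclidean_geometry.

(** * Poisson weights, and color statistics of a configuration *)

Section poisson_weights.
Context {R : realType}.
Local Open Scope ereal_scope.

Lemma poisson_prob1E (mu : R) k :
  poisson_prob mu k [set k] = (if (0 < mu)%R then poisson_pmf mu k else (k == 0%N)%:R)%:E.
Proof.
rewrite /poisson_prob; case: ifPn => mu0.
  by rewrite esum_set1// lee_fin poisson_pmf_ge0.
rewrite diracE (_ : (0%N \in [set k]) = (k == 0%N))//.
by apply/idP/eqP => [/set_mem/= <-//|->]; exact/mem_set.
Qed.

(** This is Mecke's formula for the number of points of a single color. It also
    holds at mu = 0, where the Poisson law is the Dirac mass at 0. *)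
Lemma poisson_prob_succ (mu : R) k : (0 <= mu)%R ->
  k.+1%:R%:E * poisson_prob mu k.+1 [set k.+1] = mu%:E * poisson_prob mu k [set k].
Proof.
move=> mu0; rewrite !poisson_prob1E -!EFinM; congr EFin.
case: ltgtP mu0 => [m0 _|//|<- _]; last by rewrite mulr0 mul0r.
rewrite /poisson_pmf m0 exprS factS natrM.
have f0 : (k`!%:R : R) != 0%R by rewrite pnatr_eq0 -lt0n fact_gt0.
have s0 : (k.+1%:R : R) != 0%R by rewrite pnatr_eq0.
by field; rewrite f0 addrC natr1 s0.
Qed.
End poisson_weights.

(** Removing from t and u one entry of the same color does not affect whether
    they are reorderings of each other; lift_perm ord0 r 1 moves the entry r of t
    to the front. *)
Lemma rootless_perm_eq (I : eqType) k (t u : k.+1.-tuple I) (r : 'I_k.+1) :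
  tnth t r = thead u ->
  perm_eq [tuple tnth t (lift r a) | a < k] [tuple of behead u] = perm_eq t u.
Proof.
move=> tr.
have tE : perm_eq t (thead u :: [tuple tnth t (lift r a) | a < k]).
  pose s : 'S_k.+1 := lift_perm ord0 r 1.
  rewrite perm_sym.
  apply/tuple_permP; exists s.
  have -> : [tuple tnth t (s i) | i < k.+1] =
     [tuple of thead u :: [tuple tnth t (lift r a) | a < k]] :> seq I.
    congr (val _); apply: eq_from_tnth => a; rewrite tnth_mktuple.
    case: (unliftP ord0 a) => [b ->|->]; last by rewrite lift_perm_id tr tnth0.
    by rewrite lift_perm_lift perm1 tnthS tnth_mktuple.
  by [].
rewrite (permPl tE); have {2}-> : tval u = thead u :: behead u by rewrite {1}(tuple_eta u).
by rewrite perm_cons.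
Qed.

(** An order of k.+1 points is the choice of a first point r, the root, and of
    an order s of the others. There are count_mem (thead u) u
    roots of the right color; this factor is the one that poisson_prob_succ
    absorbs in Mecke's formula. *)
Lemma sum_rooted_perm_colors (I : eqType) k (t u : k.+1.-tuple I) :
  (\sum_(r : 'I_k.+1) \sum_(s : 'S_k)
      ([tuple tnth t (lift_perm ord0 r s a) | a < k.+1] == u) =
   (\sum_(s : 'S_k) ([tuple tnth [tuple of behead u] (s a) | a < k] == [tuple of behead u])) *
   count_mem (thead u) u * perm_eq t u)%N.
Proof.
set C := (\sum_(s : 'S_k) _)%N.
transitivity (\sum_(r : 'I_k.+1) C * (perm_eq t u * (tnth t r == thead u)))%N; last first.
  rewrite -big_distrr /= -big_distrr /= -mulnA; congr (_ * _)%N; rewrite mulnC.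
  case: (boolP (perm_eq t u)) => [tu|_]; last by rewrite !muln0.
  congr (_ * _)%N; rewrite -(seq.permP tu) -sum1_count big_tuple [RHS]big_mkcond.
  by apply: eq_bigr => r _ /=; case: eqP.
apply: eq_bigr => r _; have [tr|tr] := eqVneq (tnth t r) (thead u); last first.
  rewrite !muln0 big1// => s _; apply/eqP; rewrite eqb0.
  by apply: contra tr => /eqP <-; rewrite /thead tnth_mktuple lift_perm_id.
rewrite muln1 -(rootless_perm_eq tr) /C big_distrl /=.
rewrite -(sum_perm_colors [tuple tnth t (lift r a) | a < k] [tuple of behead u]).
apply: eq_bigr => s _; congr nat_of_bool; apply/eqP/eqP => [<-|E].
  apply: eq_from_tnth => a; rewrite tnth_behead !tnth_mktuple.
  have -> : inord a.+1 = lift ord0 a :> 'I_k.+1 by apply/val_inj; rewrite /= inordK ?ltnS.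
  by rewrite lift_perm_lift.
apply: eq_from_tnth => a; rewrite tnth_mktuple.
case: (unliftP ord0 a) => [b ->|->]; last by rewrite lift_perm_id tr.
rewrite lift_perm_lift; move/(congr1 (fun v => tnth v b)): E.
by rewrite !tnth_mktuple tnth_behead => ->; congr tnth; apply/val_inj; rewrite /= inordK ?ltnS.
Qed.

Lemma perm_eq_count_mem (I : eqType) (s t : seq I) :
  (forall i, count_mem i s = count_mem i t) -> perm_eq s t.
Proof. by move=> st; apply/allP => i _ /=; rewrite st. Qed.

Section enumerations.
Context {R : realType} (E : Type) (I : finType) (B : set E) (c : E -> I).
Implicit Types (x : nat -> E) (u : seq I).

Definition color_class i : set E := B `&` c @^-1` [set i].

(** Only the multiset of the entries of u matters. Equality of counts in
    extended reals also forces finitely many points in B, and it is the form in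
    which the Poisson law is given. *)
Definition has_colors u x : Prop :=
  forall i, counting [set j | color_class i (x j)] = (count_mem i u)%:R%:E :> \bar R.

Lemma counting_enum (P : pred nat) (j : seq nat) (S : set nat) : uniq j ->
  S = [set` [seq i <- j | P i]] -> counting S = (count P j)%:R%:E :> \bar R.
Proof.
move=> uj SE; have {}SE : S = [set` seq_fset tt [seq i <- j | P i]].
  by rewrite SE; apply/seteqP; split => i; have := seq_fsetE tt [seq i <- j | P i] i => /= ->.
rewrite /counting asboolT SE; last exact: finite_fset.
by rewrite set_fsetK size_seq_fset undup_id ?filter_uniq// size_filter.
Qed.

(** Once the finitely many points in B are listed, the counts of colors are those
    of the list of their colors. *)
Lemma has_colorsE u x (j : seq nat) : uniq j -> (forall i, B (x i) <-> i \in j) ->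
  has_colors u x <-> perm_eq [seq c (x i) | i <- j] u.
Proof.
move=> uj jB.
have cE i : counting [set j | color_class i (x j)] =
    (count_mem i [seq c (x i) | i <- j])%:R%:E :> \bar R.
  rewrite count_map; apply: counting_enum => //.
  apply/seteqP; split => l /=; rewrite mem_filter.
    by move=> [/jB -> /= ->]; rewrite eqxx.
  by move=> /andP[/eqP cl lj]; split => //; apply/jB.
split => [H|H i]; last by rewrite cE (seq.permP H).
apply: perm_eq_count_mem => i.
by move: (H i); rewrite cE => -[] /eqP; rewrite eqr_nat => /eqP.
Qed.

Lemma has_colors_finite u x : has_colors u x -> finite_set [set i | B (x i)].
Proof.
move=> H; rewrite (_ : [set i | _] = \bigcup_(i in [set: I]) [set j | color_class i (x j)]).
  apply: bigcup_finite => // i _; have := H i; rewrite /counting.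
  by case: asboolP.
by apply/seteqP; split => j /=; [move=> Bj; exists (c (x j))|move=> [i _ []]].
Qed.

(** Listing the indices in increasing order makes the list unique; this will
    decompose a color event without counting anything twice. *)
Lemma has_colors_enum u x : has_colors u x ->
  exists2 j : (size u).-tuple nat, sorted ltn j & forall i, B (x i) <-> i \in val j.
Proof.
move=> H; have /has_colors_finite fB := H.
pose j := sort leq (fset_set [set i | B (x i)]).
have uj : uniq j by rewrite sort_uniq fset_uniq.
have jB i : B (x i) <-> i \in j.
  by rewrite mem_sort in_fset_set//; split => [?|/set_mem]; [exact: mem_set|].
have sj : size j == size u.
  by move/(has_colorsE u uj jB) : H => /perm_size; rewrite size_map => ->.
exists (Tuple sj) => //=.
by rewrite ltn_sorted_uniq_leq uj sort_sorted//; exact: leq_total.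
Qed.

End enumerations.

(** * Discrete decompositions of events, and Poisson color statistics *)

Section discrete_decompositions.
Context d (T : measurableType d) (R : realType) (mu : {measure set T -> \bar R}).
Local Open Scope ereal_scope.

Lemma esum_fin (J : finType) (a : J -> \bar R) : (forall j, 0 <= a j) ->
  \esum_(j in setT) a j = \sum_j a j.
Proof.
move=> a0; rewrite esum_fset//; last exact: finite_finset.
rewrite (_ : [set: J] = [set` enum J]); last first.
  by apply/seteqP; split => j //= _; rewrite mem_enum.
by rewrite -fsbig_seq ?enum_uniq// big_enum.
Qed.

Lemma esumZl (J : countType) (k : R) (a : J -> \bar R) :
  (0 <= k)%R -> (forall j, 0 <= a j) ->
  \esum_(j in setT) (k%:E * a j) = k%:E * \esum_(j in setT) a j.
Proof.
move=> k0 a0; rewrite -!nneseries_pickle//; last by move=> j; rewrite mule_ge0.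
rewrite -nneseriesZl; last by move=> n _; case: choice.pickle_inv => /=.
by apply: eq_eseriesr => n _; case: choice.pickle_inv => //=; rewrite mule0.
Qed.

Lemma measure_countable_bigcup (J : countType) (F : J -> set T) :
  (forall j, measurable (F j)) -> trivIset setT F ->
  mu (\bigcup_j F j) = \esum_(j in setT) mu (F j).
Proof.
move=> mF tF; rewrite -nneseries_pickle => [|j]; last exact: measure_ge0.
pose G n := oapp F set0 (choice.pickle_inv n).
have -> : \bigcup_j F j = \bigcup_n G n.
  apply/seteqP; split => x [].
    by move=> j _ Fx; exists (choice.pickle j) => //; rewrite /G choice.pickleK_inv.
  by move=> n _; rewrite /G; case: choice.pickle_inv => //= j Fx; exists j.
have mG n : measurable (G n) by rewrite /G; case: choice.pickle_inv => /=.
rewrite measure_semi_bigcup//.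
- by apply: eq_eseriesr => n _; rewrite /G; case: choice.pickle_inv => //=.
- apply/trivIsetP => n1 n2 _ _ n12; rewrite /G.
  case E1 : choice.pickle_inv => [j1|]; last by rewrite set0I.
  case E2 : choice.pickle_inv => [j2|]; last by rewrite setI0.
  have /= p1 := @choice.pickle_invK J n1; have /= p2 := @choice.pickle_invK J n2.
  move/trivIsetP : tF => -> //; apply: contra n12 => /eqP j12.
  move: p1 p2; rewrite E1 E2 /= => <- <-; by rewrite j12.
- exact: bigcupT_measurable.
Qed.

Lemma measure_label_event (K : finType) (A : set T) (chi : T -> K) (Q : pred K) :
  measurable A -> (forall t, measurable (chi @^-1` [set t])) ->
  mu (A `&` [set w | Q (chi w)]) =
  \sum_t (Q t)%:R%:E * mu (A `&` chi @^-1` [set t]).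
Proof.
move=> mA mchi.
rewrite (_ : _ `&` _ = \bigcup_(t in [set t | Q t]) (A `&` chi @^-1` [set t])); last first.
  apply/seteqP; split => w /=; last by move=> [t Qt [Aw ->]].
  by move=> [Aw Qw]; exists (chi w).
rewrite measure_fin_bigcup; last 3 first.
- exact: finite_finset.
- by apply/trivIsetP => t t' _ _ tt'; rewrite -subset0 => w /= [[_ tw'] [_ tw]];
  move: tt'; rewrite -tw -tw' eqxx.
- by move=> t _; exact: measurableI.
rewrite (_ : [set t | Q t] = [set` enum Q]); last first.
  by apply/seteqP; split => j /=; rewrite mem_enum.
rewrite -fsbig_seq ?enum_uniq// big_enum/= big_mkcond/=.
by apply: eq_bigr => t _; rewrite -topredE /=; case: (Q t); rewrite ?mul1e ?mul0e.
Qed.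

(** Passage from tuples of labels to probabilities: a counting identity that
    holds for each value t of a finite label, summed with weight the probability
    that the label is t. *)
Lemma weighted_label_events (K J : finType) (A : set T) (chi : T -> K)
    (Q : J -> pred K) (w : pred K) (N : nat) :
  measurable A -> (forall t, measurable (chi @^-1` [set t])) ->
  (forall t, \sum_j Q j t = N * w t)%N ->
  \sum_j mu (A `&` [set x | Q j (chi x)]) = N%:R%:E * mu (A `&` [set x | w (chi x)]).
Proof.
move=> mA mchi Qw.
rewrite (eq_bigr (fun j => \sum_t (Q j t)%:R%:E * mu (A `&` chi @^-1` [set t]))); last first.
  by move=> j _; exact: measure_label_event.
rewrite exchange_big/= measure_label_event// ge0_sume_distrr; last first.
  by move=> t _; rewrite mule_ge0// lee_fin.
apply: eq_bigr => t _; rewrite muleA -EFinM -natrM -Qw natr_sum -sumEFin.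
by rewrite ge0_sume_distrl// => j _; rewrite lee_fin.
Qed.

End discrete_decompositions.

Section poisson_colors.
Context {R : realType} {d : nat} (lambda : R).
Context {dT : measure_display} {T : measurableType dT} (P : probability T R).
Variable (X : nat -> {RV P >-> euclidean R d}).
Hypothesis poissonX : poisson_process lambda X.
Variables (B : set (euclidean R d)) (mB : measurable B).
Hypothesis finB : (tuple_lebesgue d B < +oo)%E.
Variables (I : finType) (c : euclidean R d -> I).
Hypothesis mc : coloring c.

Lemma measurable_color_class i : measurable (color_class B c i).
Proof. exact: (measurableI _ _ mB (mc i)). Qed.

Lemma color_class_lty i : (tuple_lebesgue d (color_class B c i) < +oo)%E.
Proof.
apply: le_lt_trans finB; apply: le_measure; first last.
- by move=> x [].
- exact: mem_set.
- by apply: mem_set; exact: measurable_color_class.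
Qed.

(** The points are translated by x because the Palm version will be centered at
    a point x of the box. The volumes of the color classes do not change, so
    that the probability does not depend on x. *)
Lemma poisson_has_colors (u : seq I) (x : euclidean R d) :
  P [set w | has_colors (R := R) B c u (fun i => shift x (X i w))] =
  (\prod_i poisson_prob (lambda * fine (tuple_lebesgue d (color_class B c i)))
             (count_mem i u) [set count_mem i u])%E.
Proof.
pose A i := [set y | color_class B c i (shift x y)].
have mA i : measurable (A i).
  by have := measurable_shift x measurableT (measurable_color_class i); rewrite setTI.
have volA i : tuple_lebesgue d (A i) = tuple_lebesgue d (color_class B c i).
  by apply: tuple_lebesgue_translation; exact: measurable_color_class.
have tA : trivIset setT (fun j : 'I_#|I| => A (enum_val j)).
  apply/trivIsetP => i j _ _ ij; rewrite -subset0 => y [[_ /= ci] [_ /= cj]].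
  by move: ij; rewrite -(inj_eq enum_val_inj) -ci cj eqxx.
have := poissonX (fun j => count_mem (enum_val j) u) (fun j => mA (enum_val j)) tA.
have finA (j : 'I_#|I|) : (tuple_lebesgue d (A (enum_val j)) < +oo)%E.
  by rewrite volA; exact: color_class_lty.
move=> /(_ finA) H.
transitivity (P [set w | forall j : 'I_#|I|, counting [set i | A (enum_val j) (X i w)]
    = (count_mem (enum_val j) u)%:R%:E :> \bar R]).
  congr (P _); apply/seteqP; split => w /= h i; first exact: h.
  by have := h (enum_rank i); rewrite enum_rankK.
rewrite H.
rewrite [RHS](reindex (@enum_val I xpredT)) /=; last exact: onW_bij (enum_val_bij I).
by apply: eq_bigr => j _; rewrite volA.
Qed.

End poisson_colors.

(** * The Mecke formula *)

Definition first_in (E : Type) (B : set E) (m : nat) (x : nat -> E) : Prop :=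
  forall i, B (x i) <-> (i < m)%N.

(** When B is a ball for the norm that orders the points, the points in B are
    the first ones, and their number determines which they are. *)
Lemma first_in_colors (R : realType) (E : Type) (I : finType) (B : set E) (c : E -> I)
    (u : seq I) (x : nat -> E) :
  (forall i j, (i <= j)%N -> B (x j) -> B (x i)) ->
  has_colors (R := R) B c u x <->
  first_in B (size u) x /\ perm_eq [seq c (x i) | i <- iota 0 (size u)] u.
Proof.
move=> down; split => [H|[xB]]; last first.
  have jB i : B (x i) <-> i \in iota 0 (size u) by rewrite mem_iota; exact: xB.
  by move=> pe; apply/(has_colorsE (R := R) c u (iota_uniq _ _) jB).
have [j /= sj jB] := has_colors_enum H.
have uj : uniq j by move: sj; rewrite ltn_sorted_uniq_leq => /andP[].
(* The first index outside B exists, for otherwise all the indices below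
   (size u).+1 would occur in j. *)
have [i0 ni0] : exists i, ~~ `[< B (x i) >].
  apply/not_existsP => allB.
  have : {subset iota 0 (size u).+1 <= val j}.
    by move=> i _; apply/jB; have := allB i; apply: contra_notP => /asboolPn.
  by move/(uniq_leq_size (iota_uniq _ _)); rewrite size_iota size_tuple ltnn.
pose m := ex_minn (ex_intro (fun i => ~~ `[< B (x i) >]) i0 ni0).
have xm : first_in B m x.
  rewrite /m; case: ex_minnP => n /asboolPn nBn nmin i; split => [Bi|].
    by rewrite ltnNge; apply/negP => /down/(_ Bi).
  by rewrite ltnNge => /negP ni; apply: contra_notP ni => /asboolPn; exact: nmin.
have mB i : B (x i) <-> i \in iota 0 m by rewrite mem_iota; exact: xm.
have /(has_colorsE (R := R) c u (iota_uniq _ _) mB) pe := H.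
have mu : m = size u by rewrite -(perm_size pe) size_map size_iota.
by rewrite -mu.
Qed.

Section mecke.
Context {R : realType} {d : nat} (lambda : R) (lambda0 : 0 <= lambda).
Local Notation E := (euclidean R d).
Context {dT : measure_display} {T : measurableType dT} (P : probability T R).
Context (X : nat -> {RV P >-> E}).
Context {dH : measure_display} {H : measurableType dH} (PH : probability H R).
Context (Y : nat -> {RV PH >-> E}).
Hypotheses (poissonX : poisson_process lambda X) (poissonY : poisson_process lambda Y).
Variables (B : set E) (mB : measurable B).
Hypothesis finB : (tuple_lebesgue d B < +oo)%E.
Hypothesis downB : forall i j w, (i <= j)%N -> B (X j w) -> B (X i w).
Variable k : nat.

Definition rooted_tuple (r : 'I_k.+1) (s : 'S_k) (w : T) : k.+1.-tuple E :=
  [tuple X (lift_perm ord0 r s a) w | a < k.+1].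

(** In z = (x, w), x is the distinguished point and w the Palm configuration,
    seen from the origin and moved to x. The points of B may occur anywhere in
    its enumeration, and j is the increasing list of their indices. *)
Definition palm_event (j : k.-tuple nat) : set (E * H) :=
  [set z | B z.1 /\ sorted ltn j /\ forall i, B (shift z.1 (Y i z.2)) <-> i \in j].

Definition palm_tuple (j : k.-tuple nat) (s : 'S_k) (z : E * H) : k.+1.-tuple E :=
  [tuple of z.1 :: [tuple shift z.1 (Y (tnth j (s a)) z.2) | a < k]].

(** The intensity lambda dx of the distinguished point times the law of the
    configuration around it: the right-hand side of Mecke's formula is an
    integral for this measure. *)
Definition palm_measure := mscale (NngNum lambda0) (tuple_lebesgue d \x PH)%E.
HB.instance Definition _ := Measure.on palm_measure.

Lemma measurable_first_in m : measurable [set w | first_in B m (X ^~ w)].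
Proof.
rewrite (_ : [set w | _] =
    \bigcap_i (if (i < m)%N then X i @^-1` B else ~` (X i @^-1` B))); last first.
  apply/seteqP; split => w /= h i; first by move=> _; case: ifPn => [/h//|/negP im /h].
  have := h i Logic.I; case: ifPn => im; first by move=> Bi; split.
  by move=> nBi; split => // /nBi.
apply: bigcapT_measurable => i.
have mXi : measurable (X i @^-1` B) by rewrite -[X in measurable X]setTI; exact: measurable_funP.
by case: ifPn => // _; exact: measurableC.
Qed.

Lemma measurable_shiftY i : measurable_fun setT (fun z : E * H => shift z.1 (Y i z.2)).
Proof.
apply: measurable_shift2; first exact: measurable_fst.
exact: (measurableT_comp (measurable_funP (Y i)) measurable_snd).
Qed.

Lemma measurable_palm_event j : measurable (palm_event j).
Proof.
rewrite (_ : palm_event j = (fst @^-1` B) `&` ([set z | sorted ltn j] `&`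
  \bigcap_i (if i \in val j then (fun z => shift z.1 (Y i z.2)) @^-1` B
             else ~` ((fun z => shift z.1 (Y i z.2)) @^-1` B)))); last first.
  apply/seteqP; split => z /= [Bz [sj h]]; do 2 split => //.
    by move=> i _; case: ifPn => [/h//|/negP ij /h].
  move=> i; have := h i Logic.I; case: ifPn => ij; first by move=> Bi; split.
  by move=> nBi; split => // /nBi.
apply: measurableI; first by rewrite -[X in measurable X]setTI; exact: measurable_fst.
apply: measurableI.
  by case: (sorted ltn j);
     [rewrite (_ : [set _ | _] = setT)|rewrite (_ : [set _ | _] = set0)] => //;
     apply/seteqP; split.
apply: bigcapT_measurable => i.
have mi : measurable ((fun z => shift z.1 (Y i z.2)) @^-1` B).
  by rewrite -[X in measurable X]setTI; exact: measurable_shiftY.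
by case: ifPn => // _; exact: measurableC.
Qed.

Lemma measurable_rooted_tuple r s : measurable_fun setT (rooted_tuple r s).
Proof.
apply/measurable_fun_tnthP => a.
rewrite (_ : _ \o _ = X (lift_perm ord0 r s a)); first exact: measurable_funP.
by apply/funext => w /=; rewrite tnth_mktuple.
Qed.

Lemma measurable_palm_tuple j s : measurable_fun setT (palm_tuple j s).
Proof.
apply: measurable_cons; first exact: measurable_fst.
apply/measurable_fun_tnthP => a.
rewrite (_ : _ \o _ = fun z => shift z.1 (Y (tnth j (s a)) z.2)); first exact: measurable_shiftY.
by apply/funext => w /=; rewrite tnth_mktuple.
Qed.

Section colors.
Variables (I : finType) (c : E -> I) (u : k.+1.-tuple I).
Hypothesis mc : coloring c.
Let C := (\sum_(s : 'S_k)
  ([tuple tnth [tuple of behead u] (s a) | a < k] == [tuple of behead u]))%N.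
Local Open Scope ereal_scope.

(** The points are known only as the first k.+1 ones; summing over their orders
    leaves a condition on the counts of colors in B, which the Poisson law
    determines. The translation by the origin gives both sides of Mecke's
    formula the same form. *)
Lemma rooted_colors :
  \esum_(p in [set: 'I_k.+1 * 'S_k])
     P ([set w | first_in B k.+1 (X ^~ w)] `&`
        [set w | map_tuple c (rooted_tuple p.1 p.2 w) = u]) =
  (C * count_mem (thead u) u)%:R%:E *
    P [set w | has_colors (R := R) B c u (fun i => shift origin (X i w))].
Proof.
rewrite esum_fin//.
pose chi w : k.+1.-tuple I := [tuple c (X a w) | a < k.+1].
have mchi t : measurable (chi @^-1` [set t]).
  rewrite (_ : _ @^-1` _ = \bigcap_(a in [set: 'I_k.+1]) ((X a) @^-1` (c @^-1` [set tnth t a]))).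
    apply: fin_bigcap_measurable => // a _; rewrite -[X in measurable X]setTI.
    by apply: measurable_funP => //; exact: mc.
  apply/seteqP; split => w /=; first by move=> <- a _ /=; rewrite tnth_mktuple.
  by move=> h; apply: eq_from_tnth => a; rewrite tnth_mktuple; exact: h.
have := @weighted_label_events _ _ _ P _ _ [set w | first_in B k.+1 (X ^~ w)] chi
  (fun (p : 'I_k.+1 * 'S_k) t => [tuple tnth t (lift_perm ord0 p.1 p.2 a) | a < k.+1] == u)
  (fun t => perm_eq t u) (C * count_mem (thead u) u) (measurable_first_in _) mchi.
move=> H0.
transitivity ((C * count_mem (thead u) u)%:R%:E *
   P ([set w | first_in B k.+1 (X ^~ w)] `&` [set w | perm_eq (chi w) u])).
  rewrite -H0; last first.
    by move=> t; rewrite -(sum_rooted_perm_colors t u) pair_big.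
  apply: eq_bigr => -[r s] _; congr (P (_ `&` _)); apply/seteqP; split => w /=.
    move=> <-; apply/eqP/eq_from_tnth => a.
    by rewrite !tnth_mktuple tnth_map tnth_mktuple.
  move=> /eqP <-; apply: eq_from_tnth => a.
  by rewrite tnth_map !tnth_mktuple.
have chiE w : tval (chi w) = [seq c (X i w) | i <- iota 0 k.+1].
  by rewrite -val_enum_ord -map_comp.
congr (_ * P _); apply/seteqP; split => w /=.
- rewrite (_ : (fun i => shift origin _) = X ^~ w); last by apply/funext => i; rewrite origin_shift.
  move=> [h1]; rewrite chiE => h2; apply/first_in_colors.
    by move=> i j ij; exact: downB.
  by rewrite size_tuple.
- rewrite (_ : (fun i => shift origin _) = X ^~ w); last by apply/funext => i; rewrite origin_shift.
  move=> /(first_in_colors R c u (fun i j ij => @downB i j w ij)).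
  by rewrite size_tuple chiE.
Qed.

Definition palm_color_event : set (E * H) :=
  [set z | color_class B c (thead u) z.1 /\
     has_colors (R := R) B c (behead u) (fun i => shift z.1 (Y i z.2))].

(** For fixed j the sum over the orders s leaves a condition on counts. The sum
    over j then removes j: the configuration and the box determine the list of
    indices, so that these events are disjoint and their union is
    palm_color_event. *)
Lemma palm_colors :
  \esum_(p in [set: k.-tuple nat * 'S_k])
     palm_measure (palm_event p.1 `&` [set z | map_tuple c (palm_tuple p.1 p.2 z) = u]) =
  C%:R%:E * palm_measure palm_color_event /\ measurable palm_color_event.
Proof.
pose A j := palm_event j `&` [set z | c z.1 = thead u].
pose chi (j : k.-tuple nat) z : k.-tuple I := [tuple c (shift z.1 (Y (tnth j a) z.2)) | a < k].
have mchi j t : measurable (chi j @^-1` [set t]).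
  rewrite (_ : _ @^-1` _ = \bigcap_(a in [set: 'I_k])
    ((fun z => shift z.1 (Y (tnth j a) z.2)) @^-1` (c @^-1` [set tnth t a]))).
    apply: fin_bigcap_measurable => // a _; rewrite -[X in measurable X]setTI.
    by apply: measurable_shiftY => //; exact: mc.
  apply/seteqP; split => w /=; first by move=> <- a _ /=; rewrite tnth_mktuple.
  by move=> h; apply: eq_from_tnth => a; rewrite tnth_mktuple; exact: h.
have mA j : measurable (A j).
  apply: measurableI; first exact: measurable_palm_event.
  have mfst : measurable_fun setT (fst : E * H -> E) by exact: measurable_fst.
  by have := mfst measurableT _ (mc (thead u)); rewrite setTI.
pose F j := A j `&` [set z | perm_eq (chi j z) (behead u)].
have mF j : measurable (F j).
  apply: measurableI => //.
  rewrite (_ : [set z | _] =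
      \bigcup_(t in [set t : k.-tuple I | perm_eq t (behead u)]) (chi j @^-1` [set t])).
    by apply: fin_bigcup_measurable => // t _; exact: mchi.
  apply/seteqP; split => z; first by move=> h; exists (chi j z).
  by move=> [t ht zt]; move: ht; rewrite /mkset; have <- : chi j z = t := zt.
have FE : \bigcup_j F j = palm_color_event.
  have chiE j z : tval (chi j z) = [seq c (shift z.1 (Y i z.2)) | i <- j].
    by rewrite /chi /= -[in RHS](map_tnth_enum j) -map_comp.
  apply/seteqP; split => z /=.
    move=> [j _ [[[Bz [sj jB]] cz]]] /=; rewrite chiE => pj; split => //.
    apply/(has_colorsE (R := R) c _ _ jB) => //.
    by move: sj; rewrite ltn_sorted_uniq_leq => /andP[].
  move=> [[Bz cz] hz]; have [j sj jB] := has_colors_enum hz.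
  have sz : size (behead u) = k by rewrite size_behead size_tuple.
  have Ez : palm_event (tcast sz j) z.
    by split => //; rewrite val_tcast; split => // i; rewrite memtE val_tcast.
  exists (tcast sz j) => //; split; first by split.
  rewrite /mkset chiE val_tcast.
  apply/(has_colorsE (R := R) c _ _ jB) => //.
  by move: sj; rewrite ltn_sorted_uniq_leq => /andP[].
have tF : trivIset setT F.
  apply/trivIsetP => j j' _ _ jj'; rewrite -subset0.
  move=> z [[[[_ [sj jB]] _] _] [[[_ [sj' jB']] _] _]].
  move: jj' => /negP; apply; apply/eqP/val_inj/(irr_sorted_eq ltn_trans ltnn sj sj') => i.
  by apply/idP/idP => [/jB/jB'|/jB'/jB].
split; last by rewrite -FE; apply: countable_bigcupT_measurable.
rewrite -FE measure_countable_bigcup//.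
transitivity (\esum_(j in setT) \sum_(s : 'S_k)
  palm_measure (A j `&` [set z | [tuple tnth (chi j z) (s a) | a < k] == [tuple of behead u]])).
  rewrite (_ : [set: _ * _] = setT `*`` (fun=> setT)); last by apply/seteqP; split.
  rewrite -(esum_esum (a := fun j s => palm_measure (palm_event j `&`
    [set z | map_tuple c (palm_tuple j s z) = u]))); last by move=> *; exact: measure_ge0.
  apply: eq_esum => j _; rewrite esum_fin; last by move=> s; exact: measure_ge0.
  apply: eq_bigr => s _; congr palm_measure; rewrite /A -setIA; congr (_ `&` _).
  apply/seteqP; split => z /=.
    move=> uz; split; first by rewrite -uz /thead tnth_map tnth0.
    apply/eqP; apply: eq_from_tnth => a; rewrite !tnth_mktuple tnth_behead -uz tnth_map.
    have -> : inord a.+1 = lift ord0 a :> 'I_k.+1 by apply/val_inj; rewrite /= inordK ?ltnS.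
    by rewrite tnthS tnth_mktuple.
  move=> [cz /eqP uz]; apply: eq_from_tnth => a; rewrite tnth_map.
  case: (unliftP ord0 a) => [b ->|->]; last by rewrite tnth0.
  move/(congr1 (fun v => tnth v b)) : uz.
  rewrite !tnth_mktuple tnth_behead tnthS tnth_mktuple => ->.
  by congr tnth; apply/val_inj; rewrite /= inordK ?ltnS.
transitivity (\esum_(j in setT) (C%:R%:E * palm_measure (F j))).
  apply: eq_esum => j _.
  rewrite (weighted_label_events palm_measure (w := fun t => perm_eq t (behead u)) (N := C)
     (Q := fun (s : 'S_k) t => [tuple tnth t (s a) | a < k] == [tuple of behead u])
     (mA j) (mchi j))//.
  by move=> t; rewrite /C big_distrl/= -(sum_perm_colors t [tuple of behead u]).
by rewrite esumZl// => j; exact: measure_ge0.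
Qed.

(** For each position x of the distinguished point the probability of the
    section is that of the unshifted configuration, by poisson_has_colors; what
    remains is the volume of the color class in which x has to lie. *)
Lemma palm_color_event_measure :
  palm_measure palm_color_event =
  (lambda * fine (tuple_lebesgue d (color_class B c (thead u))))%:E *
  \prod_i poisson_prob (lambda * fine (tuple_lebesgue d (color_class B c i)))
             (count_mem i (behead u)) [set count_mem i (behead u)].
Proof.
have [_ mS] := palm_colors.
rewrite /palm_measure /mscale/= EFinM -muleA; congr (_ * _).
have mD := measurable_color_class mB mc (thead u).
rewrite /product_measure1 (eq_integral (fun x => (\1_(color_class B c (thead u)) x)%:E *
  \prod_i poisson_prob (lambda * fine (tuple_lebesgue d (color_class B c i)))
             (count_mem i (behead u)) [set count_mem i (behead u)])); last first.
  move=> x _ /=; rewrite -(poisson_has_colors poissonY mB finB mc (behead u) x) indicE.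
  case: (boolP (x \in color_class B c (thead u))) => xD; rewrite ?mul1e ?mul0e.
    congr (PH _); apply/seteqP; split => w; rewrite /xsection/=; first by move=> /set_mem[].
    by move=> hw; apply: mem_set; split => //; exact: set_mem.
  rewrite -[RHS](measure0 PH); congr (PH _); apply/seteqP; split => // w.
  by rewrite /xsection/= => /set_mem[xDw _]; move/negP : xD; apply; exact: mem_set.
rewrite ge0_integralZr//; last 2 first.
- exact: measurableT_comp.
- by apply: prode_ge0 => i _; exact: measure_ge0.
rewrite integral_indic// setIT fineK// ge0_fin_numE//.
exact: (color_class_lty mB finB mc).
Qed.

(** Only the factor of the color thead u differs: one side has count_mem times
    the Poisson weight at that count, the other has the mean times the weight at
    the count without the distinguished point. *)
Lemma mecke_colors :
  \esum_(p in [set: 'I_k.+1 * 'S_k])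
     P ([set w | first_in B k.+1 (X ^~ w)] `&`
        [set w | map_tuple c (rooted_tuple p.1 p.2 w) = u]) =
  \esum_(p in [set: k.-tuple nat * 'S_k])
     palm_measure (palm_event p.1 `&` [set z | map_tuple c (palm_tuple p.1 p.2 z) = u]).
Proof.
rewrite rooted_colors palm_colors.1 palm_color_event_measure.
rewrite (poisson_has_colors poissonX mB finB mc u origin) natrM EFinM -muleA; congr (_ * _).
rewrite (bigD1 (thead u))//= [in RHS](bigD1 (thead u))//= !muleA.
have uE : tval u = thead u :: behead u by rewrite {1}(tuple_eta u).
congr (_ * _); last first.
  apply: eq_bigr => i iu; congr (poisson_prob _ _ [set _]);
  by rewrite uE /= eq_sym (negbTE iu).
rewrite {1 2 3}uE /= eqxx add1n poisson_prob_succ//.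
by rewrite mulr_ge0// fine_ge0.
Qed.
End colors.

Local Open Scope ereal_scope.

(** Mecke's formula for configurations with k.+1 points in B, in symmetrized
    form: r is the distinguished point and s an order of the others. The function
    f may depend on the order of its arguments, since both sides are summed over
    all orders. *)
Theorem mecke_transfer (f : k.+1.-tuple E -> \bar R) :
  (forall t, 0 <= f t) -> measurable_fun setT f ->
  \sum_(r < k.+1) \sum_(s : 'S_k)
    \int[P]_(w in [set w | first_in B k.+1 (X ^~ w)]) f (rooted_tuple r s w) =
  \esum_(p in [set: k.-tuple nat * 'S_k])
    \int[palm_measure]_(z in palm_event p.1) f (palm_tuple p.1 p.2 z).
Proof.
move=> f0 mf; rewrite pair_big /=.
rewrite -(esum_fin (a := fun p : 'I_k.+1 * 'S_k =>
   \int[P]_(w in [set w | first_in B k.+1 (X ^~ w)]) f (rooted_tuple p.1 p.2 w))); last first.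
  by move=> p; exact: integral_ge0.
apply: (transfer_by_colors (D1 := fun=> [set w | first_in B k.+1 (X ^~ w)])
  (V1 := fun p => rooted_tuple p.1 p.2) (D2 := fun p => palm_event p.1)
  (V2 := fun p => palm_tuple p.1 p.2)) => //.
- by move=> _; exact: measurable_first_in.
- by move=> p; exact: measurable_palm_event.
- by move=> p; exact: measurable_rooted_tuple.
- by move=> p; exact: measurable_palm_tuple.
- rewrite esum_fin// (@le_lt_trans _ _ (\sum_(p : 'I_k.+1 * 'S_k) 1))//; last first.
    by rewrite sumEFin ltry.
  by apply: lee_sum => p _; apply: probability_le1; exact: measurable_first_in.
- by move=> I c u mc; exact: mecke_colors.
Qed.

End mecke.

(** * Edge patterns of the random connection model *)

Section finite_patterns.
Context {R : realType} {d : nat} (m : nat) (g : R -> R).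
Local Notation E := (euclidean R d).
Hypothesis mg : measurable_fun [set r : R | 0 <= r] g.
Hypothesis g01 : forall r, 0 <= r -> 0 <= g r <= 1.
Implicit Types (beta : {set 'I_m * 'I_m}) (t : m.-tuple E).

Definition edge_factor (b : bool) (x y : E) : R :=
  let q := g (edist x y) in if b then q else 1 - q.

(** The conditional probability, given the locations t, that beta is the set of
    edges; edges are coded by their pairs in increasing order. *)
Definition pattern_weight beta t : R :=
  \prod_(p : 'I_m * 'I_m | (p.1 < p.2)%N) edge_factor (p \in beta) (tnth t p.1) (tnth t p.2).

Definition ordered_pairs : {set 'I_m * 'I_m} := [set p : 'I_m * 'I_m | (p.1 < p.2)%N].

Definition pattern_sum (Q : pred {set 'I_m * 'I_m}) t : R :=
  \sum_(beta : {set 'I_m * 'I_m} | (beta \subset ordered_pairs) && Q beta) pattern_weight beta t.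

Lemma edge_factor_ge0 b x y : 0 <= edge_factor b x y.
Proof.
have /andP[g0 g1] := g01 (edist_ge0 x y).
by rewrite /edge_factor; case: b; rewrite ?subr_ge0.
Qed.

Lemma pattern_weight_ge0 beta t : 0 <= pattern_weight beta t.
Proof. by apply: prodr_ge0 => p _; exact: edge_factor_ge0. Qed.

Lemma pattern_sum_ge0 Q t : 0 <= pattern_sum Q t.
Proof. by apply: sumr_ge0 => beta _; exact: pattern_weight_ge0. Qed.

Lemma pattern_sum_shift Q x t : pattern_sum Q (map_tuple (shift x) t) = pattern_sum Q t.
Proof.
apply: eq_bigr => beta _; apply: eq_bigr => p _.
by rewrite /edge_factor !tnth_map edist_shift.
Qed.

Lemma measurable_connection (dT : measure_display) (T : measurableType dT) (V W : T -> E) :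
  measurable_fun setT V -> measurable_fun setT W ->
  measurable_fun setT (fun w => g (edist (V w) (W w))).
Proof.
move=> mV mW; apply: (measurable_comp (F := [set r : R | 0 <= r])) => //.
- rewrite (_ : [set r | _] = `[0, +oo[%classic); first exact: measurable_itv.
  by apply/seteqP; split => r /=; rewrite in_itv/= andbT.
- by move=> _ [w _ <-]; exact: edist_ge0.
- exact: measurable_edist.
Qed.

Lemma measurable_pattern_weight beta : measurable_fun setT (pattern_weight beta).
Proof.
rewrite /pattern_weight; under eq_fun do rewrite -big_filter.
apply: measurable_prod => p _.
have mc : measurable_fun setT (fun t : m.-tuple E => g (edist (tnth t p.1) (tnth t p.2))).
  by apply: measurable_connection; exact: measurable_tnth.
by rewrite /edge_factor; case: (p \in beta) => //; exact: measurable_funB.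
Qed.

Lemma measurable_pattern_sum Q : measurable_fun setT (pattern_sum Q).
Proof.
rewrite /pattern_sum; under eq_fun do rewrite -big_filter.
by apply: measurable_sum => beta; exact: measurable_pattern_weight.
Qed.

End finite_patterns.

Section sorted_pairs.
Context (m : nat) (iota : 'I_m -> nat).
Hypothesis iota_inj : injective iota.

(** The law of the edges speaks of pairs i < j only, while the embedding iota of
    the m vertices into the vertices of the graph need not be increasing. *)
Definition sorted_pair (p : 'I_m * 'I_m) : nat * nat :=
  (minn (iota p.1) (iota p.2), maxn (iota p.1) (iota p.2)).

Lemma sorted_pair_inj : {in ordered_pairs m &, injective sorted_pair}.
Proof.
move=> [a b] [a' b']; rewrite !inE /= => ab ab' [].
case: (leqP (iota a) (iota b)) => h1; case: (leqP (iota a') (iota b')) => h2.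
- by move=> /iota_inj -> /iota_inj ->.
- by move=> /iota_inj E1 /iota_inj E2; move: ab ab'; rewrite E1 E2 ltnNge => /negP h /ltnW.
- by move=> /iota_inj E1 /iota_inj E2; move: ab ab'; rewrite E1 E2 ltnNge => /negP h /ltnW.
- by move=> /iota_inj -> /iota_inj ->.
Qed.

Lemma sorted_pair_lt p : p \in ordered_pairs m -> ((sorted_pair p).1 < (sorted_pair p).2)%N.
Proof.
case: p => a b; rewrite inE /= => ab.
have : iota a != iota b.
  by apply/negP => /eqP/iota_inj E; move: ab; rewrite E ltnn.
by rewrite neq_ltn /minn /maxn; case: ltngtP.
Qed.

End sorted_pairs.

Section edge_patterns.
Context {R : realType} {d : nat} (m : nat) (g : R -> R).
Local Notation E := (euclidean R d).
Hypothesis mg : measurable_fun [set r : R | 0 <= r] g.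
Hypothesis g01 : forall r, 0 <= r -> 0 <= g r <= 1.
Context {dT : measure_display} {T : measurableType dT} (P : probability T R).
Context (W : nat -> T -> E) (e : nat -> nat -> T -> bool).
Hypothesis mW : forall i, measurable_fun setT (W i).
Hypothesis me : forall i j, measurable_fun setT (e i j).
Hypothesis e_sym : forall i j w, e i j w = e j i w.
Hypothesis edge_law : forall (A : set T) (s : seq (nat * nat)) (b : nat * nat -> bool),
  sigma_seq W A -> uniq s -> all (fun p => p.1 < p.2)%N s ->
  P (A `&` [set w | forall p, p \in s -> e p.1 p.2 w = b p]) =
  (\int[P]_(w in A) (\prod_(p <- s) edge_factor g (b p) (W p.1 w) (W p.2 w))%:E)%E.

Definition pattern (iota : 'I_m -> nat) (w : T) : {set 'I_m * 'I_m} :=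
  [set p : 'I_m * 'I_m | (p.1 < p.2)%N && e (iota p.1) (iota p.2) w].

Lemma measurable_sigma_seq A : sigma_seq W A -> measurable A.
Proof.
apply: smallest_sub; first exact: sigma_algebra_measurable.
by move=> C [i _ [D mD <-]]; exact: mW.
Qed.

Lemma measurable_pattern iota beta : measurable (pattern iota @^-1` [set beta]).
Proof.
rewrite (_ : _ @^-1` _ = \bigcap_(p in [set: 'I_m * 'I_m])
   [set w | ((p.1 < p.2)%N && e (iota p.1) (iota p.2) w) = (p \in beta)]); last first.
  apply/seteqP; split => w /=; first by move=> <- p _ /=; rewrite inE.
  by move=> h; apply/setP => p; rewrite inE; exact: h.
apply: fin_bigcap_measurable; first exact: finite_finset.
move=> p _; case: (p.1 < p.2)%N => /=.
  have mb : measurable [set p \in beta] by [].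
  by have := me (iota p.1) (iota p.2) measurableT mb; rewrite setTI.
by case: (p \in beta); [rewrite (_ : [set _ | _] = set0)|rewrite (_ : [set _ | _] = setT)] => //;
  apply/seteqP; split.
Qed.

(** The law of the edges gives the conditional probability of each single
    pattern; Q is the finite disjoint union of its patterns. *)
Lemma pattern_probability (iota : 'I_m -> nat) (A : set T) (Q : pred {set 'I_m * 'I_m}) :
  injective iota -> sigma_seq W A ->
  P (A `&` [set w | Q (pattern iota w)]) =
  (\int[P]_(w in A) (pattern_sum g Q [tuple W (iota a) w | a < m])%:E)%E.
Proof.
move=> iota_inj sA; have mA := measurable_sigma_seq sA.
have mWt : measurable_fun setT (fun w => [tuple W (iota a) w | a < m]).
  apply/measurable_fun_tnthP => a.
  by rewrite (_ : _ \o _ = W (iota a))//; apply/funext => w /=; rewrite tnth_mktuple.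
rewrite measure_label_event//; last exact: measurable_pattern.
under eq_integral do rewrite /pattern_sum big_mkcond -sumEFin.
rewrite ge0_integral_sum//; first last.
- by move=> beta w _; rewrite lee_fin; case: ifP => // _; exact: pattern_weight_ge0.
- move=> beta; apply/measurable_EFinP; apply: measurable_funTS.
  case: ((beta \subset _) && Q beta) => //.
  exact: (measurableT_comp (measurable_pattern_weight mg beta) mWt).
apply: eq_bigr => beta _.
case: (boolP (beta \subset ordered_pairs m)) => [sbeta|nsbeta]; last first.
  rewrite integral0 (_ : pattern iota @^-1` _ = set0) ?setI0 ?measure0 ?mule0//.
  apply/seteqP; split => // w /= wb; move/negP : nsbeta; apply.
  by apply/fintype.subsetP => p; rewrite -wb !inE => /andP[].
case: (Q beta) => /=; last by rewrite integral0 mul0e.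
rewrite mul1e.
pose s := [seq sorted_pair iota p | p <- enum (ordered_pairs m)].
pose b q := [exists p in ordered_pairs m, (sorted_pair iota p == q) && (p \in beta)].
have bE p : p \in ordered_pairs m -> b (sorted_pair iota p) = (p \in beta).
  move=> op; apply/existsP/idP => [[p' /and3P[op' /eqP E' pb']]|pb].
    by rewrite -(sorted_pair_inj iota_inj op' op E').
  by exists p; rewrite op eqxx pb.
have eE p w : e (sorted_pair iota p).1 (sorted_pair iota p).2 w = e (iota p.1) (iota p.2) w.
  by rewrite /sorted_pair /minn /maxn /=; case: ifP.
transitivity (P (A `&` [set w | forall p, p \in s -> e p.1 p.2 w = b p])).
  congr (P (_ `&` _)); apply/seteqP; split => w /=.
    move=> wb _ /mapP[p + ->]; rewrite mem_enum => op; rewrite bE// eE -wb inE.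
    by move: op; rewrite inE => ->.
  move=> h; apply/setP => p; rewrite inE; case: (boolP (p \in ordered_pairs m)) => op.
    have : sorted_pair iota p \in s by apply/mapP; exists p; rewrite ?mem_enum.
    by move=> /h; rewrite eE bE// => ->; move: op; rewrite inE => ->.
  have -> : (p \in beta) = false by apply: contraNF op; exact: (fintype.subsetP sbeta).
  by move: op; rewrite inE; case: (p.1 < p.2)%N.
rewrite edge_law//.
- apply: eq_integral => w _; congr EFin.
  rewrite /s big_map big_enum/= /pattern_weight; apply: eq_big => p; first by rewrite inE.
  move=> op; rewrite bE// /edge_factor !tnth_mktuple /sorted_pair /minn /maxn /=.
  by case: (iota p.1 < iota p.2)%N => //=; rewrite edist_sym.
- rewrite map_inj_in_uniq ?enum_uniq// => p q; rewrite !mem_enum => op oq.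
  exact: sorted_pair_inj.
- by apply/allP => _ /mapP[p + ->]; rewrite mem_enum => /(sorted_pair_lt iota_inj).
Qed.

End edge_patterns.

(** * Clusters of vertex 0 and clusters of patterns *)

Section cluster_sizes.
Context {R : realType} {dT : measure_display} {T : measurableType dT} (P : probability T R).
Variable e : nat -> nat -> T -> bool.
Hypothesis me : forall i j, measurable_fun setT (e i j).

Definition cluster_of_zero (w : T) : set nat := component (fun i j => e i j w) 0.

Definition cluster_atleast (K : nat) : set T :=
  [set w | exists s : seq nat, [/\ uniq s, size s = K &
     forall j, j \in s -> cluster_of_zero w j]].

Lemma measurable_path i (p : seq nat) :
  measurable [set w | path (fun i j => e i j w) i p].
Proof.
elim: p i => [|j p IH] i /=; first by rewrite (_ : [set _ | _] = setT)//; apply/seteqP; split.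
rewrite (_ : [set _ | _] = (e i j @^-1` [set true]) `&` [set w | path (fun i j => e i j w) j p]).
  apply: measurableI; last exact: IH.
  by rewrite -[X in measurable X]setTI; exact: (me i j measurableT).
by apply/seteqP; split => w /=; [move=> /andP[-> ->]|move=> [-> ->]].
Qed.

Lemma measurable_cluster_atleast K : measurable (cluster_atleast K).
Proof.
have mcomp j : measurable [set w | cluster_of_zero w j].
  rewrite (_ : [set w | _] = \bigcup_(p : seq nat)
     (if last 0%N p == j then [set w | path (fun i j => e i j w) 0 p] else set0)).
    apply: countable_bigcupT_measurable => [|p]; first exact: countableP.
    by case: ifP => // _; exact: measurable_path.
  apply/seteqP; split => w /=.
    by move=> [p [pp lp]]; exists p => //; rewrite lp eqxx.
  by move=> [p _]; case: eqP => // lp pp; exists p.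
rewrite (_ : cluster_atleast K = \bigcup_(s : seq nat)
   (if uniq s && (size s == K) then \bigcap_(j in [set` s]) [set w | cluster_of_zero w j]
    else set0)).
  apply: countable_bigcupT_measurable => [|s]; first exact: countableP.
  case: ifP => // _; apply: fin_bigcap_measurable => //; exact: finite_seq.
apply/seteqP; split => w.
  by move=> [s [us sK sc]]; exists s => //; rewrite us sK eqxx => j; exact: sc.
move=> [s _]; case: ifP => // /andP[us /eqP sK] sc.
by exists s; split.
Qed.

(** Size at least K is defined by K distinct members, and not by a cardinal, so
    that it also makes sense for infinite clusters; an infinite cluster is one
    that passes this test for every K. *)
Lemma cluster_atleast_infinite :
  \bigcap_K cluster_atleast K = [set w | infinite_set (cluster_of_zero w)].
Proof.
apply/seteqP; split => w.
  move=> h fin; have [s [us sK sc]] := h #|` fset_set (cluster_of_zero w)|.+1 Logic.I.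
  have := uniq_leq_size us (s2 := fset_set (cluster_of_zero w)).
  rewrite sK ltnn => sub; suff : false by [].
  by apply: sub => j /sc cj; rewrite in_fset_set//; exact: mem_set.
move=> inf K _; have [A sA AK] := infinite_set_fset K inf.
exists (take K A); split; first by rewrite take_uniq// fset_uniq.
  by rewrite size_take_min; apply/minn_idPl.
by move=> j /mem_take jA; exact: sA.
Qed.

(** Continuity from above along the decreasing events of
    cluster_atleast_infinite. *)
Lemma cluster_atleast_small (eps : R) : (0 < eps) ->
  P [set w | infinite_set (cluster_of_zero w)] = 0%E ->
  exists K, (P (cluster_atleast K) < eps%:E)%E.
Proof.
move=> eps0; rewrite -cluster_atleast_infinite => P0.
have mC := measurable_cluster_atleast.
have nC : nonincreasing_seq cluster_atleast.
  move=> K L KL; apply/subsetPset => w [s [us sL sc]].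
  exists (take K s); split; first exact: take_uniq.
    by rewrite size_take_min sL; apply/minn_idPl.
  by move=> j /mem_take; exact: sc.
have cvP : (P \o cluster_atleast) @ \oo --> 0%E.
  rewrite -P0; apply: nonincreasing_cvg_mu => //.
    by apply: le_lt_trans (probability_le1 P (mC 0%N)) _; exact: ltry.
  exact: bigcapT_measurable.
have : \forall K \near \oo, (P (cluster_atleast K) < eps%:E)%E.
  apply: (cvP [set x | (x < eps%:E)%E]); apply: open_nbhs_nbhs.
  by split; [exact: open_ereal_lt_ereal|rewrite /= lte_fin].
by move=> [K _ KP]; exists K; exact: KP K (leqnn K).
Qed.

End cluster_sizes.

Section pattern_clusters.
Context (m : nat).

Definition pattern_rel (beta : {set 'I_m * 'I_m}) : rel 'I_m :=
  fun a b => ((a, b) \in beta) || ((b, a) \in beta).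

Lemma connect_relabel (pi : {perm 'I_m}) (e : rel 'I_m) a b :
  connect (fun x y => e (pi x) (pi y)) a b = connect e (pi a) (pi b).
Proof.
apply/connectP/connectP => [[p pp ->]|[p pp lp]].
  exists (map pi p); last by rewrite last_map.
  by rewrite path_map.
exists (map (pi^-1)%g p); last first.
  by apply: (@perm_inj _ pi); rewrite lp -(last_map pi) -map_comp
     map_id_in// => x _ /=; rewrite permKV.
have : path (relpre pi e) a (map (pi^-1)%g p).
  by rewrite -path_map -map_comp map_id_in// => x _ /=; rewrite permKV.
by [].
Qed.

Lemma card_connect_relabel (pi : {perm 'I_m}) (e : rel 'I_m) a :
  #|connect (fun x y => e (pi x) (pi y)) a| = #|connect e (pi a)|.
Proof.
rewrite -(fintype.card_image (@perm_inj _ pi) (connect _ a)); apply: eq_card => b.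
rewrite !inE -[b](permKV pi) fintype.mem_image; last exact: perm_inj.
by rewrite inE connect_relabel.
Qed.

End pattern_clusters.

Section clusters_of_patterns.
Context {dT : measure_display} {T : measurableType dT} (k : nat) (e : nat -> nat -> T -> bool).
Hypothesis e_sym : forall i j w, e i j w = e j i w.
Hypothesis e_irr : forall i w, e i i w = false.

Definition root_cluster_atleast K (beta : {set 'I_k.+1 * 'I_k.+1}) : bool :=
  (K <= #|connect (pattern_rel beta) ord0|)%N.

Lemma pattern_relE (iota : 'I_k.+1 -> nat) w a b :
  pattern_rel (pattern e iota w) a b = e (iota a) (iota b) w.
Proof.
rewrite /pattern_rel !inE /= [e (iota b) _ _]e_sym -andb_orl.
by case: (ltngtP a b) => //= /val_inj ->; rewrite e_irr.
Qed.

(** By relabelling, every vertex of the window can be made the root. *)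
Lemma root_cluster_perm K (pi : 'S_k.+1) w :
  root_cluster_atleast K (pattern e (fun a => pi a) w) =
  (K <= #|connect (fun a b : 'I_k.+1 => e a b w) (pi ord0)|)%N.
Proof.
rewrite /root_cluster_atleast -(card_connect_relabel pi (fun a b : 'I_k.+1 => e a b w)).
by congr (_ <= _)%N; apply: eq_card => b; apply: eq_connect => x y; exact: pattern_relE.
Qed.

(** Restricting the graph to finitely many vertices can only shrink a cluster;
    this is the right direction to bound the number of bad vertices from above. *)
Lemma root_cluster_grows K (iota : 'I_k.+1 -> nat) w :
  injective iota -> iota ord0 = 0%N ->
  root_cluster_atleast K (pattern e iota w) -> cluster_atleast e K w.
Proof.
move=> iota_inj iota0; rewrite /root_cluster_atleast => Kc.
set C := connect _ _ in Kc.
exists (take K (map iota (enum C))); split.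
- by rewrite take_uniq// map_inj_uniq// enum_uniq.
- by rewrite size_take_min size_map -cardE; apply/minn_idPl.
move=> j /mem_take/mapP[b + ->]; rewrite mem_enum => /connectP[p pp ->].
exists (map iota p); rewrite -iota0 last_map; split => //.
rewrite path_map; apply: sub_path pp => x y /=.
by rewrite pattern_relE.
Qed.

End clusters_of_patterns.

(** * Expected number of vertices in large clusters *)

Section sigma_seq_events.
Context {R : realType} {dT : measure_display} {T : measurableType dT}.
Context {d' : measure_display} {E : measurableType d'} (W : nat -> T -> E).

(** The law of the edges is conditional on events generated by the locations;
    which points lie in B is such an event. *)
Lemma sigma_seq_membership (B : set E) (S : pred nat) : measurable B ->
  sigma_seq W [set w | forall i, B (W i w) <-> S i].
Proof.
move=> mB; rewrite (_ : [set w | _] =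
    \bigcap_i (if S i then W i @^-1` B else ~` (W i @^-1` B))); last first.
  apply/seteqP; split => w /= h i; first by move=> _; case: ifPn => [/h//|/negP im /h].
  have := h i Logic.I; case: ifPn => im; first by move=> Bi; split.
  by move=> nBi; split => // /nBi.
have mi i : sigma_seq W (W i @^-1` B).
  apply: sub_sigma_algebra; exists i => //; exists B => //.
  by rewrite setTI.
apply: (@bigcapT_measurable _ (g_sigma_algebraType (\bigcup_i sigma_rv (W i)))) => i.
case: ifP => _; first exact: mi.
by apply: (@measurableC _ (g_sigma_algebraType (\bigcup_i sigma_rv (W i)))); exact: mi.
Qed.

End sigma_seq_events.

Section fubini_bound.
Context d1 d2 (S : measurableType d1) (H : measurableType d2) (R : realType).
Context (mu : {sigma_finite_measure set S -> \bar R}) (PH : {sigma_finite_measure set H -> \bar R}).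
Local Open Scope ereal_scope.

Lemma fubini_section_bound (D : set (S * H)) (C : set H) (h : S * H -> \bar R) :
  measurable D -> measurable C -> measurable_fun setT h -> (forall z, 0 <= h z) ->
  (forall x, \int[PH]_(w in xsection D x) h (x, w) <= PH (xsection D x `&` C)) ->
  \int[mu \x PH]_(z in D) h z <= (mu \x PH) (D `&` snd @^-1` C).
Proof.
move=> mD mC mh h0 hC.
have mhD : measurable_fun setT (h \_ D).
  by apply/(measurable_restrictT _ mD); exact: measurable_funTS.
have hD0 z : 0 <= (h \_ D) z by rewrite patchE; case: ifP.
have mDC : measurable (D `&` snd @^-1` C).
  apply: measurableI => //; rewrite -[X in measurable X]setTI.
  exact: measurable_snd.
rewrite integral_mkcond fubini_tonelli1//.
apply: ge0_le_integral => //.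
- by move=> x _; apply: integral_ge0.
- exact: measurable_fun_fubini_tonelli_F.
- exact: (measurable_fun_xsection PH mDC).
move=> x _; rewrite /fubini_F /=.
rewrite (_ : xsection (D `&` snd @^-1` C) x = xsection D x `&` C); last first.
  apply/seteqP; split => w; rewrite /xsection/=.
    by move=> /set_mem[Dz Cw]; split => //; exact: mem_set.
  by move=> [/set_mem Dz Cw]; apply/mem_set; split.
apply: le_trans (hC x); rewrite [leRHS]integral_mkcond le_eqVlt; apply/orP; left.
apply/eqP; apply: eq_integral => w _; rewrite !patchE.
by rewrite (_ : (w \in xsection D x) = ((x, w) \in D))// mem_xsection.
Qed.

End fubini_bound.

Section cluster_mecke_bound.
Context {R : realType} {d : nat} (lambda : R) (lambda0 : 0 <= lambda).
Local Notation E := (euclidean R d).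
Context {dT : measure_display} {T : measurableType dT} (P : probability T R).
Context (X : nat -> {RV P >-> E}).
Context {dH : measure_display} {H : measurableType dH} (PH : probability H R).
Context (Y : nat -> {RV PH >-> E}).
Hypotheses (poissonX : poisson_process lambda X) (poissonY : poisson_process lambda Y).
Variables (B : set E) (mB : measurable B).
Hypothesis finB : (tuple_lebesgue d B < +oo)%E.
Hypothesis downB : forall i j w, (i <= j)%N -> B (X j w) -> B (X i w).
Variable g : R -> R.
Hypothesis mg : measurable_fun [set r : R | 0 <= r] g.
Hypothesis g01 : forall r, 0 <= r -> 0 <= g r <= 1.
Context (eX : nat -> nat -> T -> bool) (eY : nat -> nat -> H -> bool).
Hypotheses (meX : forall i j, measurable_fun setT (eX i j))
           (meY : forall i j, measurable_fun setT (eY i j)).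
Hypotheses (eX_sym : forall i j w, eX i j w = eX j i w)
           (eY_sym : forall i j w, eY i j w = eY j i w).
Hypotheses (eX_irr : forall i w, eX i i w = false)
           (eY_irr : forall i w, eY i i w = false).
Hypothesis eX_law : forall (A : set T) (s : seq (nat * nat)) (b : nat * nat -> bool),
  sigma_seq (fun i => X i : T -> E) A -> uniq s -> all (fun p => p.1 < p.2)%N s ->
  P (A `&` [set w | forall p, p \in s -> eX p.1 p.2 w = b p]) =
  (\int[P]_(w in A) (\prod_(p <- s) edge_factor g (b p) (X p.1 w) (X p.2 w))%:E)%E.
Let W := palm_locations (fun i => Y i : H -> E).
Hypothesis eY_law : forall (A : set H) (s : seq (nat * nat)) (b : nat * nat -> bool),
  sigma_seq W A -> uniq s -> all (fun p => p.1 < p.2)%N s ->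
  PH (A `&` [set w | forall p, p \in s -> eY p.1 p.2 w = b p]) =
  (\int[PH]_(w in A) (\prod_(p <- s) edge_factor g (b p) (W p.1 w) (W p.2 w))%:E)%E.
Variables (k K : nat).
Let Q := @root_cluster_atleast k K.
Local Open Scope ereal_scope.

Definition palm_size_event : set (E * H) := \bigcup_(j : k.-tuple nat) palm_event Y B j.

Lemma measurable_palm_locations i : measurable_fun setT (W i).
Proof. by case: i => [|i]; [exact: measurable_cst|exact: measurable_funP]. Qed.

(** Conditionally on the locations, pattern_sum g Q is the probability that the
    root r has a large cluster among the points of the box, whatever the order s
    of the other points. *)
Lemma rooted_side (r : 'I_k.+1) (s : 'S_k) :
  \int[P]_(w in [set w | first_in B k.+1 (X ^~ w)]) (pattern_sum g Q (rooted_tuple X r s w))%:E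
  = P ([set w | first_in B k.+1 (X ^~ w)] `&`
       [set w | (K <= #|connect (fun a b : 'I_k.+1 => eX a b w) r|)%N]).
Proof.
pose iota (a : 'I_k.+1) : nat := lift_perm ord0 r s a.
have iota_inj : injective iota by move=> a b /val_inj/perm_inj.
rewrite /rooted_tuple -(pattern_probability mg g01 _ meX eX_sym eX_law Q iota_inj); first last.
- exact: sigma_seq_membership.
- by move=> i; exact: measurable_funP.
congr (P (_ `&` _)); apply/seteqP; split => w /=;
  by rewrite /Q /iota (root_cluster_perm eX_sym eX_irr) lift_perm_id.
Qed.

(** For a fixed position x of the root: pattern_sum depends on distances only, so
    that x may be moved to the origin, where the law of the Palm graph applies.
    Its finite cluster is contained in the full cluster of vertex 0. *)
Lemma palm_side (j : k.-tuple nat) (s : 'S_k) :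
  \int[palm_measure lambda0 PH]_(z in palm_event Y B j) (pattern_sum g Q (palm_tuple Y j s z))%:E
  <= palm_measure lambda0 PH (palm_event Y B j `&` snd @^-1` cluster_atleast eY K).
Proof.
have mC := measurable_cluster_atleast meY K.
have mD := measurable_palm_event Y mB j.
have mf : measurable_fun setT (fun z : E * H => (pattern_sum g Q (palm_tuple Y j s z))%:E).
  apply/measurable_EFinP.
  exact: (measurableT_comp (measurable_pattern_sum mg Q) (measurable_palm_tuple Y j s)).
rewrite /palm_measure ge0_integral_mscale//; last first.
- by move=> z _; rewrite lee_fin; exact: pattern_sum_ge0.
- exact: measurable_funTS.
rewrite /mscale/= lee_wpmul2l//.
apply: fubini_section_bound => //.
  by move=> z; rewrite lee_fin; exact: pattern_sum_ge0.
move=> x.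
case: (boolP (`[< B x >] && sorted ltn j)) => [/andP[/asboolP Bx sj]|nBs]; last first.
  rewrite (_ : xsection _ _ = set0) ?integral_set0 ?measure_ge0//.
  apply/seteqP; split => // w; rewrite /xsection/= => /set_mem[/= Bx [sj _]].
  by move: nBs; rewrite sj andbT => /asboolPn.
have uj : uniq j by move: sj; rewrite ltn_sorted_uniq_leq => /andP[].
(* Vertex 0 is the root, and the point of index i is vertex i.+1. *)
pose iota (a : 'I_k.+1) : nat := oapp (fun b => (tnth j (s b)).+1) 0%N (unlift ord0 a).
have iota0 : iota ord0 = 0%N by rewrite /iota unlift_none.
have iotaS b : iota (lift ord0 b) = (tnth j (s b)).+1 by rewrite /iota liftK.
have iota_inj : injective iota.
  move=> a b; case: (unliftP ord0 a) => [a' ->|->]; case: (unliftP ord0 b) => [b' ->|->];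
    rewrite ?iota0 ?iotaS//.
  by move=> [] /(tuple_uniqP _ uj)/perm_inj ->.
have tE w : palm_tuple Y j s (x, w) = map_tuple (shift x) [tuple W (iota a) w | a < k.+1].
  apply: eq_from_tnth => a; rewrite tnth_map tnth_mktuple.
  case: (unliftP ord0 a) => [b ->|->]; last by rewrite tnth0 iota0 shift_origin.
  by rewrite iotaS tnthS tnth_mktuple.
have sD : sigma_seq W (xsection (palm_event Y B j) x).
  have mBx : measurable [set y | B (shift x y)].
    by have := measurable_shift x measurableT mB; rewrite setTI.
  pose S i := if i is i'.+1 then i' \in val j else true.
  suff -> : xsection (palm_event Y B j) x =
    [set w | forall i, [set y | B (shift x y)] (W i w) <-> S i].
    exact: (sigma_seq_membership S mBx).
  apply/seteqP; split => w; rewrite /xsection/=.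
    move=> /set_mem[/= _ [_ h]] [|i]; first by rewrite shift_origin.
    exact: h.
  by move=> h; apply/mem_set; split => //; split => // i; exact: (h i.+1).
under eq_integral do rewrite tE pattern_sum_shift.
rewrite -(pattern_probability mg g01 measurable_palm_locations meY eY_sym eY_law Q iota_inj sD).
have mDx := measurable_sigma_seq measurable_palm_locations sD.
have mQ : measurable [set w | Q (pattern eY iota w)].
  rewrite (_ : [set w | _] =
    \bigcup_(beta in [set beta | Q beta]) (pattern eY iota @^-1` [set beta])).
    apply: fin_bigcup_measurable; first exact: finite_finset.
    by move=> beta _; exact: measurable_pattern.
  apply/seteqP; split => w; first by move=> h; exists (pattern eY iota w).
  by move=> [beta hb]; rewrite /preimage /mkset => ->.
apply: le_measure.
- by apply: mem_set; exact: measurableI.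
- by apply: mem_set; exact: measurableI.
- by apply: setIS => w; exact: root_cluster_grows.
Qed.

Lemma trivIset_palm_event : trivIset setT (palm_event (k := k) Y B).
Proof.
apply/trivIsetP => j j' _ _ jj'; rewrite -subset0 => z [[_ [sj jB]] [_ [sj' jB']]].
move: jj' => /negP; apply; apply/eqP/val_inj/(irr_sorted_eq ltn_trans ltnn sj sj') => i.
by apply/idP/idP => [/jB/jB'|/jB'/jB].
Qed.

(** Mecke's formula applied to the conditional probability that the root has a
    large cluster. By rooted_side and palm_side the order s of the other points
    disappears from both sides, and the number k! of orders cancels. *)
Theorem cluster_mecke_bound :
  \sum_(r < k.+1) P ([set w | first_in B k.+1 (X ^~ w)] `&`
     [set w | (K <= #|connect (fun a b : 'I_k.+1 => eX a b w) r|)%N])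
  <= palm_measure lambda0 PH (palm_size_event `&` snd @^-1` cluster_atleast eY K).
Proof.
have mC : measurable (snd @^-1` cluster_atleast eY K : set (E * H)).
  rewrite -[X in measurable X]setTI; apply: measurable_snd => //.
  exact: measurable_cluster_atleast.
have mDC (j : k.-tuple nat) : measurable (palm_event Y B j `&` snd @^-1` cluster_atleast eY K).
  by apply: measurableI => //; exact: measurable_palm_event.
have f0 (t : k.+1.-tuple E) : 0 <= (pattern_sum g Q t)%:E.
  by rewrite lee_fin; exact: pattern_sum_ge0.
have mf : measurable_fun setT (fun t : k.+1.-tuple E => (pattern_sum g Q t)%:E).
  by apply/measurable_EFinP; exact: measurable_pattern_sum.
have := mecke_transfer lambda0 poissonX poissonY mB finB downB f0 mf.
under eq_bigr do under eq_bigr do rewrite rooted_side.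
set N := #|{: 'S_k}|.
have N0 : (0 < N%:R :> R)%R by rewrite ltr0n /N card_Sn fact_gt0.
under eq_bigr => r _.
  rewrite (_ : \sum_(s : 'S_k) _ = N%:R%:E * P ([set w | first_in B k.+1 (X ^~ w)] `&`
     [set w | (K <= #|connect (fun a b : 'I_k.+1 => eX a b w) r|)%N])); last first.
    by rewrite sumr_const mule_natl.
  over.
rewrite -ge0_sume_distrr; last by move=> r _; exact: measure_ge0.
move=> sumE; rewrite -(@lee_pmul2l _ N%:R%:E)//.
rewrite sumE /palm_size_event setI_bigcupl measure_countable_bigcup//; last first.
  by apply/trivIsetP => j j' _ _ jj'; rewrite setIACA (trivIsetP.1 trivIset_palm_event)// set0I.
rewrite -esumZl//.
rewrite (_ : [set: _ * _] = setT `*`` (fun=> setT)); last by apply/seteqP; split.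
rewrite -(esum_esum (a := fun j s => \int[palm_measure lambda0 PH]_(z in palm_event Y B j)
   (pattern_sum g Q (palm_tuple Y j s z))%:E)); last first.
  by move=> *; apply: integral_ge0 => z _; rewrite lee_fin; exact: pattern_sum_ge0.
apply: le_esum => j _; rewrite esum_fin; last first.
  by move=> s; apply: integral_ge0 => z _; rewrite lee_fin; exact: pattern_sum_ge0.
apply: le_trans (lee_sum _ (fun s _ => palm_side j s)) _.
by rewrite sumr_const mule_natl.
Qed.

End cluster_mecke_bound.

(** * Grouping independent sources *)

Section independence.
Context {R : realType} {dT : measure_display} {T : measurableType dT} (P : probability T R).
Context {I : eqType} (D : set I) (F : I -> set (set T)).
Hypothesis indep : mutually_independent P D F.
Hypotheses (FI : forall i, setI_closed (F i)) (FT : forall i, F i setT)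
  (Fm : forall i, D i -> F i `<=` measurable).
Local Open Scope ereal_scope.

(** The finite intersections of events of the group form a pi-system, on which
    the product rule is mutual independence itself; both sides are finite
    measures in A. *)
Lemma independent_of_group (L : set I) (s : seq I) (Ev : I -> set T) (A : set T) :
  L `<=` D -> uniq s -> (forall i, i \in s -> [/\ D i, ~ L i & F i (Ev i)]) ->
  <<s \bigcup_(i in L) F i >> A ->
  P (A `&` \bigcap_(i in [set` s]) Ev i) = P A * \prod_(i <- s) P (Ev i).
Proof.
move=> LD us sEv sA; set B := \bigcap_(i in _) _.
have mB : measurable B.
  apply: fin_bigcap_measurable => [|i /= si]; first exact: finite_seq.
  by have [Di _ Fi] := sEv _ si; exact: Fm Fi.
pose G := [set S | exists (t : seq I) (C : I -> set T), [/\ uniq t,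
  forall i, i \in t -> L i /\ F i (C i) & S = \bigcap_(i in [set` t]) C i]].
have Gm : G `<=` measurable.
  move=> _ [t [C [ut tC ->]]]; apply: fin_bigcap_measurable => [|i /= ti]; first exact: finite_seq.
  by have [Li Fi] := tC _ ti; apply: (Fm _ Fi); exact: LD.
have GI : setI_closed G.
  move=> _ _ [t1 [C1 [ut1 tC1 ->]]] [t2 [C2 [ut2 tC2 ->]]].
  exists (undup (t1 ++ t2)), (fun i => (if i \in t1 then C1 i else setT) `&`
                                       (if i \in t2 then C2 i else setT)).
  split; first exact: undup_uniq.
    move=> i; rewrite mem_undup mem_cat => /orP it; split.
      by case: it => [/tC1[]|/tC2[]].
    rewrite /=; apply: FI.
      by case: (boolP (i \in t1)) => [it1|_] //; have [] := tC1 _ it1.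
    by case: (boolP (i \in t2)) => [it2|_] //; have [] := tC2 _ it2.
  apply/seteqP; split => w /=.
    move=> [h1 h2] i /= _; split; first by case: ifP => // /h1.
    by case: ifP => // /h2.
  move=> h; split => i /= ti.
    have := h i; rewrite /= mem_undup mem_cat ti => /(_ isT)[].
    by [].
  have := h i; rewrite /= mem_undup mem_cat ti orbT => /(_ isT)[] _.
  by [].
have GT : G setT by exists [::], (fun=> setT); split => //; rewrite bigcapT.
have subG : \bigcup_(i in L) F i `<=` G.
  move=> S [i Li Fi]; exists [:: i], (fun=> S); split => //.
    by move=> j; rewrite inE => /eqP ->.
  apply/seteqP; split => w /=; first by move=> Sw j _.
  by move=> /(_ i); apply; rewrite /= inE.
pose c := \prod_(i <- s) P (Ev i).
have c0 : 0 <= c by apply: prode_ge0 => i _; exact: measure_ge0.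
have Pfin i : i \in s -> P (Ev i) \is a fin_num.
  by move=> /sEv[Di _ Fi]; apply: fin_num_measure; exact: Fm Fi.
have cfin : c \is a fin_num.
  rewrite /c; elim: (s) Pfin => [|i t IH] tfin; first by rewrite big_nil.
  rewrite big_cons fin_numM ?tfin ?mem_head ?IH// => j jt.
  by apply: tfin; rewrite inE jt orbT.
have cge0 : (0 <= fine c)%R by exact: fine_ge0.
have -> : P (A `&` B) = mrestr P mB A by [].
have -> : P A * c = mscale (NngNum cge0) P A.
  rewrite /mscale /=. by rewrite fineK// muleC.
apply: (g_sigma_algebra_measure_unique G Gm (fun=> setT)) => //.
- by rewrite predeqE => x; split => // _; exists 0%N.
- move=> _ [t [C [ut tC ->]]]; rewrite /= /mrestr /mscale /= fineK// muleC.
  have nst i : i \in t -> i \notin s.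
    by move=> /tC[Li _]; apply/negP => /sEv[_ nLi _]; exact: nLi.
  rewrite (indep ut (E := C)); last by move=> i /tC[Li Fi]; split => //; exact: LD.
  rewrite (_ : _ `&` B = \bigcap_(i in [set` t ++ s]) (if i \in t then C i else Ev i)); last first.
    apply/seteqP; split => w /=.
      move=> [tw sw] i /=; rewrite mem_cat; case: ifP => [it _|_ /= si]; first exact: tw.
      exact: sw.
    move=> h; split => i /= ii.
      by have := h i; rewrite /= mem_cat ii; apply.
    have := h i; rewrite /= mem_cat ii orbT.
    by case: ifP => [/nst|_]; [rewrite ii|apply].
  rewrite indep.
  + rewrite big_cat; congr (_ * _); rewrite [LHS]big_seq [RHS]big_seq; apply: eq_bigr => i it.
      by rewrite it.
    by rewrite (_ : (i \in t) = false)//; apply/negP => /nst; rewrite it.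
  + rewrite cat_uniq ut us andbT; apply/hasPn => i si; apply/negP => /nst.
    by rewrite si.
  + move=> i; rewrite mem_cat; case: ifP => [it _|_ /= si].
      by have [Li Fi] := tC _ it; split => //; exact: LD.
    by have [Di _ Fi] := sEv _ si.
- move=> _; apply: (@le_lt_trans _ _ 1); last exact: ltry.
  by apply: probability_le1; exact: measurableI.
- by apply: sub_sigma_algebra2 sA.
Qed.

End independence.

(** * Integrating out an independent uniform mark *)

Section independent_mark.
Context {R : realType} {dT : measure_display} {T : measurableType dT} (P : probability T R).
Context (G : set (set T)) (Gm : G `<=` measurable).
Context (V : {RV P >-> R}) (Q : probability (measurableTypeR R) R).
Hypothesis indepV : forall A B, <<s G >> A -> measurable B ->
  (P (A `&` V @^-1` B) = P A * Q B)%E.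
Local Notation TG := (g_sigma_algebraType G).
Local Open Scope ereal_scope.

(* With the smaller sigma-algebra on T, the joint law of the sample and the
   mark is a product, and Fubini's theorem applies to it. *)
Let forget : T -> TG := idfun.

Let mforget : measurable_fun setT forget.
Proof.
move=> _ A mA; rewrite setTI.
exact: (smallest_sub (@sigma_algebra_measurable _ T) Gm) mA.
Qed.

(** The mark V is integrated out first, the rest of the sample being fixed. The
    integrand may depend on the sample through G only, which is the meaning of
    its measurability for TG. *)
Lemma integral_independent_mark (Phi : TG * measurableTypeR R -> \bar R) :
  measurable_fun setT Phi -> (forall z, 0 <= Phi z) ->
  \int[P]_w Phi (w, V w) = \int[P]_w \int[Q]_u Phi (w, u).
Proof.
move=> mPhi Phi0.
pose forgetRV : {RV P >-> TG} := HB.pack forget (isMeasurableFun.Build _ _ _ _ forget mforget).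
pose PG : probability TG R := distribution P forgetRV.
have mpair : measurable_fun setT (fun w : T => (forget w, V w : measurableTypeR R)).
  by apply/measurable_fun_pair => //; exact: (measurable_funP V).
transitivity (\int[measure_function_pushforward__canonical__measure_function_Measure
    P mpair]_z Phi z).
  by rewrite ge0_integral_pushforward//= preimage_setT.
transitivity (\int[PG \x Q]_z Phi z).
  apply: eq_measure_integral => A mA _; symmetry; apply: product_measure_unique => //.
rewrite fubini_tonelli1// ge0_integral_pushforward//=; last first.
- by move=> x _; apply: integral_ge0.
- exact: measurable_fun_fubini_tonelli_F.
Qed.

End independent_mark.

Section uniform_marks.
Context {R : realType}.
Local Open Scope ereal_scope.

Lemma uniform_prob_itv (a b : R) : (0 <= a)%R -> (a <= b)%R -> (b <= 1)%R ->
  uniform_prob (@ltr01 R) `]a, b]%classic = (b - a)%:E.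
Proof.
move=> a0 ab b1; rewrite /uniform_prob integral_uniform_pdf setIidl; last first.
  by move=> x /=; rewrite !in_itv/= => /andP[ax xb]; apply/andP; split; lra.
rewrite (eq_integral (fun=> 1)); last first.
  move=> x /set_mem/=; rewrite in_itv/= => /andP[ax xb]; rewrite /uniform_pdf subr0 invr1 ifT//.
  by apply/andP; split; lra.
rewrite integral_cst// mul1e [LHS]lebesgue_measure_itv/= lte_fin.
case: ltP => [_|ba]; first by rewrite EFinB.
have -> : b = a by lra.
by rewrite subrr.
Qed.

Lemma integral_uniform_indicator (a b : R) (beta : bool) :
  (0 <= a)%R -> (a <= b)%R -> (b <= 1)%R ->
  \int[uniform_prob (@ltr01 R)]_u ((((a < u)%R && (u <= b)%R) == beta)%:R)%:E =
  (if beta then b - a else 1 - (b - a))%:E.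
Proof.
move=> a0 ab b1.
have mI : measurable (`]a, b]%classic : set (measurableTypeR R)) by exact: measurable_itv.
pose S : set (measurableTypeR R) := if beta then `]a, b]%classic else ~` `]a, b]%classic.
have mS : measurable S by rewrite /S; case: (beta) => //; exact: measurableC.
rewrite (eq_integral (fun u => (\1_S u)%:E)); last first.
  move=> u _; rewrite indicE /S; congr (_%:R%:E).
  clear mS S; have iE : (u \in `]a, b]%classic) = (a < u)%R && (u <= b)%R.
    by rewrite mem_setE in_itv.
  by case: beta; rewrite ?in_setC iE; case: (_ && _).
rewrite integral_indic// setIT /S; clear S mS; case: beta; first exact: uniform_prob_itv.
rewrite [LHS](probability_setC (uniform_prob (@ltr01 R)) mI) EFinB; congr (_ - _).
exact: uniform_prob_itv.
Qed.

End uniform_marks.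

(** * The informative graph of the block model *)

Section block_model_sources.
Context {R : realType} {dT : measure_display} {T : measurableType dT} (P : probability T R).
Context (d : nat) (lambda : R).
Local Notation E := (euclidean R d).
Context (X : nat -> {RV P >-> E}) (Z : nat -> {RV P >-> bool})
  (U : nat -> nat -> {RV P >-> R}).
Hypothesis sbm : block_model lambda X Z U.

Let src := sbm_source X Z U.
Let valid : set (option (nat + nat * nat)) :=
  [set s | if s is Some (inr (i, j)) then (i < j)%N : Prop else True].

Lemma setI_closed_source s : setI_closed (src s).
Proof.
have rvI d' (E' : measurableType d') (V : T -> E') : setI_closed (sigma_rv V).
  move=> _ _ [B mB <-] [C mC <-]; exists (B `&` C); first exact: measurableI.
  by rewrite preimage_setI !setTI.
case: s => [[i|[i j]]|]; [exact: rvI|exact: rvI|].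
move=> B C sB sC.
exact: (@measurableI _ (g_sigma_algebraType (\bigcup_i sigma_rv (X i))) _ _ sB sC).
Qed.

Lemma setT_source s : src s setT.
Proof.
have rvT d' (E' : measurableType d') (V : T -> E') : sigma_rv V setT.
  by exists setT => //; rewrite preimage_setT setTI.
case: s => [[i|[i j]]|]; [exact: rvT|exact: rvT|].
exact: (@measurableT _ (g_sigma_algebraType (\bigcup_i sigma_rv (X i)))).
Qed.

Lemma measurable_source s : src s `<=` measurable.
Proof.
case: s => [[i|[i j]]|].
- by move=> _ [B mB <-]; exact: (measurable_funP (Z i)).
- by move=> _ [B mB <-]; exact: (measurable_funP (U i j)).
- by move=> A; apply: measurable_sigma_seq => i; exact: (measurable_funP (X i)).
Qed.

Definition sources (L : set (option (nat + nat * nat))) : set (set T) :=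
  \bigcup_(l in L) src l.

Lemma measurable_sources L : sources L `<=` measurable.
Proof. by move=> A [l _]; exact: measurable_source. Qed.

Lemma source_independence (L : set (option (nat + nat * nat)))
    (s : seq (option (nat + nat * nat))) (Ev : option (nat + nat * nat) -> set T) (A : set T) :
  L `<=` valid -> uniq s ->
  (forall i, i \in s -> [/\ valid i, ~ L i & src i (Ev i)]) ->
  <<s sources L >> A ->
  P (A `&` \bigcap_(i in [set` s]) Ev i) = (P A * \prod_(i <- s) P (Ev i))%E.
Proof.
case: sbm => _ _ _ ind; apply: (independent_of_group ind).
- exact: setI_closed_source.
- exact: setT_source.
- by move=> i _; exact: measurable_source.
Qed.

Lemma sources_X (L : set (option (nat + nat * nat))) i : L None ->
  measurable_fun setT (X i : g_sigma_algebraType (sources L) -> E).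
Proof.
move=> LN _ A mA; rewrite setTI; apply: sub_sigma_algebra; exists None => //.
apply: sub_sigma_algebra; exists i => //; exists A => //; by rewrite setTI.
Qed.

Lemma sources_U (L : set (option (nat + nat * nat))) i j : L (Some (inr (i, j))) ->
  measurable_fun setT (U i j : g_sigma_algebraType (sources L) -> R).
Proof.
move=> LN _ A mA; rewrite setTI; apply: sub_sigma_algebra; exists (Some (inr (i, j))) => //.
exists A => //; by rewrite setTI.
Qed.

Lemma sources_mono (L M : set (option (nat + nat * nat))) d' (E' : measurableType d')
    (h : T -> E') : L `<=` M ->
  measurable_fun setT (h : g_sigma_algebraType (sources L) -> E') ->
  measurable_fun setT (h : g_sigma_algebraType (sources M) -> E').
Proof.
move=> LM mh _ A mA; have := mh measurableT A mA.
by apply: sub_sigma_algebra2; exact: bigcup_subset.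
Qed.

Lemma sources_measurable (L : set (option (nat + nat * nat))) d' (E' : measurableType d')
    (h : T -> E') :
  measurable_fun setT (h : g_sigma_algebraType (sources L) -> E') -> measurable_fun setT h.
Proof.
move=> mh _ A mA; have := mh measurableT A mA.
exact: (smallest_sub (@sigma_algebra_measurable _ T) (@measurable_sources L)).
Qed.

Section informative_edges.
Variables (f_in f_out : R -> R).
Hypotheses (m_in : measurable_fun [set r : R | 0 <= r] f_in)
  (m_out : measurable_fun [set r : R | 0 <= r] f_out).
Hypothesis f01 : forall r, 0 <= r -> [/\ 0 <= f_in r <= 1, 0 <= f_out r <= 1 & f_out r <= f_in r].

Definition informative (i j : nat) (w : T) : bool :=
  [&& i != j, f_out (edist (X i w) (X j w)) < U i j w &
      U i j w <= f_in (edist (X i w) (X j w))].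

Definition thinned (r : R) : R := f_in r - f_out r.

Lemma measurable_thinned : measurable_fun [set r : R | 0 <= r] thinned.
Proof. exact: measurable_funB. Qed.

Lemma thinned01 r : 0 <= r -> 0 <= thinned r <= 1.
Proof.
move=> /f01[/andP[i0 i1] /andP[p0 p1] oi]; rewrite /thinned; apply/andP; split; lra.
Qed.

Lemma informative_sym i j w : informative i j w = informative j i w.
Proof.
case: sbm => _ _ [Usym _] _.
by rewrite /informative eq_sym edist_sym Usym.
Qed.

Lemma informative_irr i w : informative i i w = false.
Proof. by rewrite /informative eqxx. Qed.

Lemma measurable_bool_natr : measurable_fun setT (fun b : bool => b%:R : R).
Proof. by move=> _ A mA; rewrite setTI. Qed.

Lemma sources_connection (L : set (option (nat + nat * nat))) (f : R -> R) i j : L None ->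
  measurable_fun [set r : R | 0 <= r] f ->
  measurable_fun setT ((fun w => f (edist (X i w) (X j w))) :
    g_sigma_algebraType (sources L) -> R).
Proof. by move=> LN mf; apply: measurable_connection => //; exact: sources_X. Qed.

Lemma sources_informative (L : set (option (nat + nat * nat))) i j : L None ->
  L (Some (inr (i, j))) ->
  measurable_fun setT (informative i j : g_sigma_algebraType (sources L) -> bool).
Proof.
move=> LN LU; rewrite /informative; case: (i != j) => //=.
by apply: measurable_and; apply: measurable_fun_ltr || apply: measurable_fun_ler;
  (exact: sources_connection || exact: sources_U).
Qed.

Lemma measurable_informative i j : measurable_fun setT (informative i j).
Proof. by apply: (sources_measurable (L := setT)); exact: sources_informative. Qed.

Definition informative_pattern (s : seq (nat * nat)) (b : nat * nat -> bool) (w : T) : bool :=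
  all (fun p => informative p.1 p.2 w == b p) s.

Local Open Scope ereal_scope.

(** The marks are integrated out one at a time. The mark of the first pair q is
    independent of the locations and of the other marks; integrating it replaces
    its indicator by the factor of q, which depends on the locations only and is
    absorbed into the weight h. *)
Lemma informative_pattern_integral (s : seq (nat * nat)) (b : nat * nat -> bool) (h : T -> R) :
  uniq s -> all (fun p => p.1 < p.2)%N s -> (forall w, 0 <= h w)%R ->
  measurable_fun setT (h : g_sigma_algebraType (sources [set None]) -> R) ->
  \int[P]_w (h w * (informative_pattern s b w)%:R)%:E =
  \int[P]_w (h w * \prod_(p <- s) edge_factor thinned (b p) (X p.1 w) (X p.2 w))%:E.
Proof.
elim: s h => [|q s IH] h; first by move=> *; apply: eq_integral => w _; rewrite big_nil.
rewrite /= => /andP[qs us] /andP[q12 s12] h0 mh.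
pose L : set (option (nat + nat * nat)) :=
  [set l | match l with None => True | Some (inr p) => p \in s | _ => False end].
have LN : L None by [].
have NL : [set None] `<=` L by move=> _ ->.
pose r w := edist (X q.1 w) (X q.2 w).
pose Phi (z : g_sigma_algebraType (sources L) * measurableTypeR R) : \bar R :=
  (h z.1 * (informative_pattern s b z.1)%:R *
   (((f_out (r z.1) < z.2)%R && (z.2 <= f_in (r z.1))%R) == b q)%:R)%:E.
have mpat : measurable_fun setT (informative_pattern s b : g_sigma_algebraType (sources L) -> bool).
  rewrite /informative_pattern.
  have : {subset s <= s} by [].
  elim: {1 3}s => [|p s1 IHs] ss1 //=.
  apply: measurable_and; last by apply: IHs => p1 p1s; apply: ss1; rewrite inE p1s orbT.
  have mp := @sources_informative L p.1 p.2 LN.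
  have /mp {}mp : L (Some (inr (p.1, p.2))).
    by rewrite -surjective_pairing; apply: ss1; rewrite mem_head.
  move=> _ A mA; rewrite setTI.
  by have := mp measurableT [set x | A (x == b p)] Logic.I; rewrite setTI.
have mPhi : measurable_fun setT Phi.
  apply/measurable_EFinP; apply: measurable_funM.
    apply: measurable_funM.
      exact: (measurableT_comp (sources_mono NL mh) measurable_fst).
    exact: (measurableT_comp measurable_bool_natr (measurableT_comp mpat measurable_fst)).
  apply: (measurableT_comp measurable_bool_natr).
  have mb : measurable_fun setT (fun z : g_sigma_algebraType (sources L) * measurableTypeR R =>
       (f_out (r z.1) < z.2)%R && (z.2 <= f_in (r z.1))%R).
    have mo := sources_connection q.1 q.2 LN m_out.
    have mi := sources_connection q.1 q.2 LN m_in.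
    apply: measurable_and.
      apply: measurable_fun_ltr; last exact: measurable_snd.
      exact: (measurableT_comp mo measurable_fst).
    apply: measurable_fun_ler; first exact: measurable_snd.
    exact: (measurableT_comp mi measurable_fst).
  move=> _ A mA; rewrite setTI.
  by have := mb measurableT [set x | A (x == b q)] Logic.I; rewrite setTI.
have Phi0 z : 0 <= Phi z by rewrite lee_fin mulr_ge0// mulr_ge0.
transitivity (\int[P]_w Phi (w, U q.1 q.2 w)).
  apply: eq_integral => w _; rewrite /Phi /= -mulrA -natrM mulnb andbC.
  congr ((h w * (_ && (_ == b q))%:R)%:E).
  by rewrite /informative (ltn_eqF q12).
rewrite (integral_independent_mark (G := sources L) _
  (Q := uniform_prob (@ltr01 R))) //; first last.
- move=> A B sA mB.
  have := @source_independence L [:: Some (inr q)] (fun=> U q.1 q.2 @^-1` B) A.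
  rewrite big_seq1 (_ : \bigcap_(i in _) _ = U q.1 q.2 @^-1` B); last first.
    apply/seteqP; split => w /=; first by move=> /(_ (Some (inr q))); apply; rewrite /= inE.
    by move=> h' _ _.
  move=> ->//.
  + by case: sbm => _ _ [_ UP] _; congr (_ * _); exact: (UP q.1 q.2 B q12 mB).
  + by move=> [[|[i j]]|] //= /(allP s12).
  + move=> i; rewrite inE => /eqP ->; split => //=.
    * by case: (q) q12.
    * exact/negP.
    * by case: (q) => i' j'; exists B => //; rewrite setTI.
- exact: measurable_sources.
rewrite (eq_integral (fun w => (h w * edge_factor thinned (b q) (X q.1 w) (X q.2 w)
    * (informative_pattern s b w)%:R)%:E)); last first.
  move=> w _; rewrite /Phi /=.
  under eq_integral do rewrite EFinM.
  have [/andP[i0 i1] /andP[p0 p1] oi] := f01 (edist_ge0 (X q.1 w) (X q.2 w)).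
  rewrite ge0_integralZl_EFin//; last 2 first.
  + apply/measurable_EFinP; apply: (measurableT_comp measurable_bool_natr).
    have mb : measurable_fun setT (fun u : measurableTypeR R =>
       (f_out (r w) < u)%R && (u <= f_in (r w))%R).
      by apply: measurable_and; [apply: measurable_fun_ltr|apply: measurable_fun_ler].
    move=> _ A mA; rewrite setTI.
    by have := mb measurableT [set x | A (x == b q)] Logic.I; rewrite setTI.
  + by rewrite mulr_ge0.
  rewrite integral_uniform_indicator// -EFinM; congr EFin.
  by rewrite mulrAC.
rewrite (IH (fun w => h w * edge_factor thinned (b q) (X q.1 w) (X q.2 w))%R us s12); last 2 first.
- by move=> w; rewrite mulr_ge0// edge_factor_ge0//; exact: thinned01.
- apply: measurable_funM => //.
  have mc := @sources_connection [set None] thinned q.1 q.2 erefl measurable_thinned.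
  by rewrite /edge_factor; case: (b q) => //; exact: measurable_funB.
by apply: eq_integral => w _; rewrite big_cons mulrA.
Qed.

(** The interval from f_out(r) to f_in(r) has length f_in(r) - f_out(r), which is
    the probability that a uniform mark falls in it. The weight h is the indicator
    of the event A. *)
Lemma informative_law (A : set T) (s : seq (nat * nat)) (b : nat * nat -> bool) :
  sigma_seq (fun i => X i : T -> E) A -> uniq s -> all (fun p => p.1 < p.2)%N s ->
  P (A `&` [set w | forall p, p \in s -> informative p.1 p.2 w = b p]) =
  \int[P]_(w in A) (\prod_(p <- s) edge_factor thinned (b p) (X p.1 w) (X p.2 w))%:E.
Proof.
move=> sA us s12.
have mA : measurable A by exact: (@measurable_source None).
have mAN : measurable (A : set (g_sigma_algebraType (sources [set None]))).
  by apply: sub_sigma_algebra; exists None.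
have A0 w : (0 <= \1_A w :> R)%R by rewrite indicE.
have := informative_pattern_integral b us s12 A0 (@measurable_indic _ _ R setT _ mAN).
rewrite [in X in _ = X -> _](eq_integral ((fun w =>
  (\prod_(p <- s) edge_factor thinned (b p) (X p.1 w) (X p.2 w))%:E) \_ A)); last first.
  by move=> w _; rewrite patchE indicE; case: (w \in A); rewrite ?mul1r ?mul0r.
rewrite -integral_mkcond => <-.
pose S := [set w | informative_pattern s b w].
have -> : [set w | forall p, p \in s -> informative p.1 p.2 w = b p] = S.
  apply/seteqP; split => w /= h; first by apply/allP => p /h ->.
  by move=> p ps; apply/eqP; exact: (allP h).
have mS : measurable S.
  rewrite (_ : S = \bigcap_(p in [set` s]) (informative p.1 p.2 @^-1` [set b p])).
    apply: fin_bigcap_measurable => [|p _]; first exact: finite_seq.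
    have mb : measurable [set b p] by [].
    by have := @measurable_informative p.1 p.2 measurableT _ mb; rewrite setTI.
  apply/seteqP; split => w /= h; first by move=> p /= ps; apply/eqP; exact: (allP h).
  by apply/allP => p ps; apply/eqP; exact: h.
have mAS := measurableI _ _ mA mS.
transitivity (\int[P]_w (\1_(A `&` S) w)%:E); first by rewrite integral_indic// setIT.
apply: eq_integral => w _; rewrite !indicE in_setI -natrM mulnb.
by congr ((_ && _)%:R%:E); apply/idP/idP => [/set_mem//|h]; exact: mem_set.
Qed.

End informative_edges.
End block_model_sources.

(** * Second moment of the overlap *)

Section weighted_indicators.
Context {R : realType} {dT : measure_display} {T : measurableType dT} (P : probability T R).
Local Open Scope ereal_scope.

Lemma integral_weighted_indicators (J : finType) (D : set T) (b : J -> T -> bool) (c : J -> R) :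
  measurable D -> (forall j, measurable_fun setT (b j)) -> (forall j, 0 <= c j)%R ->
  \int[P]_(w in D) (\sum_j c j * (b j w)%:R)%:E = \sum_j (c j)%:E * P (D `&` [set w | b j w]).
Proof.
move=> mD mb c0.
have mbR j : measurable_fun setT (fun w => (b j w)%:R : R).
  exact: (measurableT_comp measurable_bool_natr (mb j)).
under eq_integral do rewrite -sumEFin.
rewrite ge0_integral_sum//; last 2 first.
- move=> j; apply/measurable_EFinP; apply: measurable_funTS.
  by apply: measurable_funM.
- by move=> j w _; rewrite lee_fin mulr_ge0.
apply: eq_bigr => j _; under eq_integral do rewrite EFinM.
rewrite ge0_integralZl_EFin//; last first.
- by apply/measurable_EFinP; exact: measurable_funTS.
congr (_ * _).
have mS : measurable [set w | b j w].
  have mt : measurable [set true] by [].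
  have := mb j measurableT _ mt; rewrite setTI.
  by congr measurable; apply/seteqP; split.
rewrite setIC -integral_indic//; apply: eq_integral => w _; rewrite indicE.
by congr ((nat_of_bool _)%:R%:E); apply/idP/idP => [h|/set_mem//]; exact: mem_set.
Qed.
End weighted_indicators.

Section second_moment.
Context {R : realType} {dT : measure_display} {T : measurableType dT} (P : probability T R).
Context (d : nat) (lambda : R) (f_in f_out : R -> R).
Local Notation E := (euclidean R d).
Context (X : nat -> {RV P >-> E}) (Z : nat -> {RV P >-> bool})
  (U : nat -> nat -> {RV P >-> R}).
Hypothesis sbm : block_model lambda X Z U.
Hypotheses (m_in : measurable_fun [set r : R | 0 <= r] f_in)
  (m_out : measurable_fun [set r : R | 0 <= r] f_out).
Hypothesis f01 : forall r, 0 <= r -> [/\ 0 <= f_in r <= 1, 0 <= f_out r <= 1 & f_out r <= f_in r].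
Variables (B : set E) (mB : measurable B).
Variables (m : nat) (est : {mfun (m.-tuple E * m.-tuple (m.-tuple bool))%type >-> m.-tuple bool}).
Implicit Types z : {ffun 'I_m -> bool}.

(** The graph drawn with a prescribed labelling z in place of the random labels:
    on the event that the labels are z the two agree, and the prescribed version
    is independent of the labels. *)
Definition labelled_edge z (i j : 'I_m) (w : T) : bool :=
  (i != j) && (U i j w <= if z i == z j then f_in (edist (X i w) (X j w))
                          else f_out (edist (X i w) (X j w))).

Definition labelled_observation z (w : T) : m.-tuple E * m.-tuple (m.-tuple bool) :=
  ([tuple X i w | i < m], [tuple [tuple labelled_edge z i j w | j < m] | i < m]).

Definition labelled_sum z (w : T) : R :=
  \sum_(i < m) spin (tnth (est (labelled_observation z w)) i) * spin (z i).

Let linked w : rel 'I_m := fun a b => informative X U f_in f_out a b w.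

(** The endpoints of an informative pair lie in the same cluster and are flipped
    together. For another pair the mark is at most f_out or above f_in, and there
    is an edge, or none, whatever the labels are. *)
Lemma labelled_observation_flip z i w :
  labelled_observation (flip_cluster (linked w) i z) w = labelled_observation z w.
Proof.
congr pair; apply: eq_from_tnth => a; rewrite !tnth_mktuple; apply: eq_from_tnth => b.
rewrite !tnth_mktuple /labelled_edge; have [//|ab /=] := eqVneq a b.
have [_ _ oi] := f01 (edist_ge0 (X a w) (X b w)).
case: (boolP (linked w a b)) => [Iab|nIab].
  have -> : (flip_cluster (linked w) i z a == flip_cluster (linked w) i z b) = (z a == z b).
    rewrite !ffunE; have -> : connect (linked w) i a = connect (linked w) i b.
      apply/idP/idP => h; apply: (connect_trans h); apply: connect1 => //.
      by rewrite /linked (informative_sym sbm).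
    by case: (z a); case: (z b); case: connect.
  by [].
have : (U a b w <= f_out (edist (X a w) (X b w))) || (f_in (edist (X a w) (X b w)) < U a b w).
  move: nIab; rewrite /linked /informative.
  have -> : (nat_of_ord a != nat_of_ord b) by [].
  by rewrite /= negb_and -leNgt -ltNge.
case/orP => h.
  by do 2 case: ifP => _; apply/idP/idP => _ //; lra.
by do 2 case: ifP => _; apply/idP/idP => h' //; lra.
Qed.

Lemma labelled_second_moment K w :
  \sum_z labelled_sum z w ^+ 2 <=
  (2 ^ m)%:R * ((K * m)%:R + m%:R * \sum_(i < m) (K <= #|connect (linked w) i|)%N%:R).
Proof.
apply: le_trans (_ : (2 ^ m)%:R * \sum_i #|connect (linked w) i|%:R <= _); last first.
  by rewrite ler_wpM2l//; exact: sum_cluster_sizes.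
apply: (@cluster_second_moment _ _ _ (fun z => tnth (est (labelled_observation z w)))).
by move=> z i; rewrite labelled_observation_flip.
Qed.

Let L : set (option (nat + nat * nat)) :=
  [set s | match s with None => True | Some (inr (i, j)) => (i < j)%N : Prop | _ => False end].
Let TL := g_sigma_algebraType (sources X Z U L).

Lemma sources_labelled_sum z : measurable_fun setT (labelled_sum z : TL -> R).
Proof.
have LN : L None by [].
have [_ _ [Usym _] _] := sbm.
have mU (i j : nat) : i != j -> measurable_fun setT (U i j : TL -> R).
  move=> ij; have [lt|gt|E'] := ltngtP i j.
  - exact: sources_U.
  - rewrite (_ : (U i j : TL -> R) = U j i); last by apply/funext => w; exact: Usym.
    exact: sources_U.
  - by move: ij; rewrite E' eqxx.
have mobs : measurable_fun setT (labelled_observation z : TL -> _).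
  apply/measurable_fun_pair; apply/measurable_fun_tnthP => i.
    rewrite (_ : _ \o _ = X i); last by apply/funext => w /=; rewrite tnth_mktuple.
    exact: sources_X.
  rewrite (_ : _ \o _ = fun w => [tuple labelled_edge z i j w | j < m]); last first.
    by apply/funext => w /=; rewrite tnth_mktuple.
  apply/measurable_fun_tnthP => j.
  rewrite (_ : _ \o _ = labelled_edge z i j); last by apply/funext => w /=; rewrite tnth_mktuple.
  rewrite /labelled_edge; case: (eqVneq i j) => //= ij.
  apply: measurable_fun_ler; first exact: mU.
  by case: (z i == z j); exact: sources_connection.
apply: measurable_sum => i; apply: measurable_funM => //.
have mspin : measurable_fun setT (@spin R) by move=> _ A mA; rewrite setTI.
apply: (measurableT_comp mspin).
apply: (measurableT_comp (measurable_tnth i)).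
exact: (measurableT_comp (measurable_funP est) mobs).
Qed.

Definition labelling z (w : T) : Prop := forall i : 'I_m, Z i w = z i.

Lemma labelled_observationE z w : labelling z w ->
  observation f_in f_out X Z U m w = labelled_observation z w.
Proof.
move=> zw; congr pair; apply: eq_from_tnth => i; rewrite !tnth_mktuple.
by apply: eq_from_tnth => j; rewrite !tnth_mktuple /sbm_edge !zw.
Qed.

Local Open Scope ereal_scope.

Lemma labelling_independent z (A : set T) : <<s sources X Z U L >> A ->
  P (A `&` labelling z) = (2 ^- m)%:E * P A.
Proof.
move=> sA; have [_ PZ _ _] := sbm.
pose zx i := oapp z false (insub i : option 'I_m).
pose Ev (s : option (nat + nat * nat)) : set T :=
  if s is Some (inl i) then Z i @^-1` [set zx i] else setT.
pose s : seq (option (nat + nat * nat)) := [seq Some (inl i) | i <- iota 0 m].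
have us : uniq s by rewrite map_inj_uniq ?iota_uniq// => i j [].
have := source_independence sbm (L := L) (Ev := Ev) _ us _ sA.
rewrite (_ : \bigcap_(i in _) _ = labelling z); last first.
  apply/seteqP; split => w.
    move=> h i; have := h (Some (inl (i : nat))); rewrite /Ev /= => ->.
      by rewrite /zx valK.
    by apply/mapP; exists (i : nat) => //; rewrite mem_iota /=.
  move=> h _ /= /mapP[i + ->]; rewrite mem_iota /= => im.
  by rewrite /Ev /= (h (Ordinal im)) /zx insubT.
move=> ->; last 2 first.
- by move=> [[|[i j]]|].
- move=> _ /mapP[i _ ->]; split => //.
  by exists [set zx i] => //; rewrite setTI.
rewrite muleC; congr (_ * _); rewrite big_map.
under eq_bigr do rewrite /Ev PZ.
have powE n j : \prod_(i <- iota j n) (2^-1 : R)%:E = (2 ^- n)%:E.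
  elim: n j => [|n IHn] j; first by rewrite big_nil expr0 invr1.
  by rewrite /= big_cons IHn -EFinM exprS invfM.
exact: powE.
Qed.

Definition overlap_event (gamma : R) : set T :=
  [set w | first_in B m (X ^~ w)] `&`
  [set w | gamma <= `|\sum_(i < m) spin (tnth (est (observation f_in f_out X Z U m w)) i)
                          * spin (Z i w)| / m%:R]%R.

(** Chebyshev's inequality. Splitting according to the labelling z makes the
    probability an average, over the 2^m labellings, of probabilities that do not
    involve the labels; the pointwise bound labelled_second_moment is then
    integrated. *)
Lemma overlap_bound (K : nat) (gamma : R) : (0 < gamma)%R -> (0 < m)%N ->
  measurable (overlap_event gamma) /\
  ((gamma * m%:R) ^+ 2)%:E * P (overlap_event gamma) <=
  (K * m)%:R%:E * P [set w | first_in B m (X ^~ w)] +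
  m%:R%:E * \sum_(r < m) P ([set w | first_in B m (X ^~ w)] `&`
                            [set w | (K <= #|connect (linked w) r|)%N]).
Proof.
move=> gamma0 m0.
set Em := [set w | first_in B m (X ^~ w)].
have sEm : <<s sources X Z U L >> Em.
  apply: sub_sigma_algebra; exists None => //.
  exact: (@sigma_seq_membership _ _ _ _ (fun i => X i : T -> E) B (fun i => (i < m)%N) mB).
have mEm : measurable Em.
  exact: (smallest_sub (@sigma_algebra_measurable _ T)
    (@measurable_sources _ _ _ _ _ X Z U L)).
pose b z w := (gamma * m%:R <= `|labelled_sum z w|)%R.
have mbL z : measurable_fun setT (b z : TL -> bool).
  apply: measurable_fun_ler => //; apply: measurableT_comp => //.
  exact: sources_labelled_sum.
have mb z : measurable_fun setT (b z) := sources_measurable (mbL z).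
have sA z : <<s sources X Z U L >> (Em `&` [set w | b z w]).
  apply: (@measurableI _ TL) => //.
  have mt : measurable [set true] by [].
  have := mbL z measurableT _ mt; rewrite setTI.
  by congr (<<s _ >> _); apply/seteqP; split.
have mA z : measurable (Em `&` [set w | b z w]).
  exact: (smallest_sub (@sigma_algebra_measurable _ T) (@measurable_sources _ _ _ _ _ X Z U L)).
have mlab z : measurable (labelling z).
  rewrite (_ : labelling z = \bigcap_(i in [set: 'I_m]) (Z i @^-1` [set z i])).
    apply: fin_bigcap_measurable; first exact: finite_finset.
    by move=> i _; rewrite -[X in measurable X]setTI; exact: measurable_funP.
  by apply/seteqP; split => w /= h i; [move=> _|]; exact: h.
(* Where the labels are z, the estimator sees the observation drawn with z. *)
rewrite (_ : overlap_event gamma =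
    \bigcup_(z in [set: {ffun 'I_m -> bool}])
      ((Em `&` [set w | b z w]) `&` labelling z)); last first.
  have bE z w : labelling z w -> b z w = (gamma <= `|\sum_(i < m)
      spin (tnth (est (observation f_in f_out X Z U m w)) i) * spin (Z i w)| / m%:R)%R.
    move=> zw; rewrite /b ler_pdivlMr ?ltr0n// (labelled_observationE zw).
    by congr (_ <= `|_|)%R; apply: eq_bigr => i _; rewrite zw.
  apply/seteqP; split => w.
    move=> [Ew gw]; exists [ffun i : 'I_m => Z i w] => //.
    have zw : labelling [ffun i : 'I_m => Z i w] w by move=> i; rewrite ffunE.
    by split => //; split => //; rewrite /mkset bE.
  by move=> [z _ [[Ew bw] zw]]; split => //; rewrite /mkset -(bE z).
split.
  apply: fin_bigcup_measurable; first exact: finite_finset.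
  by move=> z _; exact: measurableI.
rewrite measure_fin_bigcup; last 3 first.
- exact: finite_finset.
- apply/trivIsetP => z z' _ _ zz'; rewrite -subset0 => w [[_ h] [_ h']].
  by move/negP : zz'; apply; apply/eqP/ffunP => i; rewrite -h -h'.
- by move=> z _; exact: measurableI.
rewrite (_ : [set: _] = [set` enum {ffun 'I_m -> bool}]); last first.
  by apply/seteqP; split => z //= _; rewrite mem_enum.
rewrite -fsbig_seq ?enum_uniq// big_enum/=.
under eq_bigr do rewrite labelling_independent//.
have p2 : (0 < 2 ^+ m :> R)%R by rewrite exprn_gt0.
rewrite -ge0_sume_distrr//.
rewrite muleCA -(@lee_pmul2l _ (2 ^+ m)%:E)//.
rewrite muleA -EFinM mulfV ?gt_eqF// mul1e.
rewrite ge0_sume_distrr//.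
rewrite -(integral_weighted_indicators P (c := fun=> ((gamma * m%:R) ^+ 2)%R) mEm mb); last first.
  by move=> z; exact: sqr_ge0.
(* The size of a cluster is measurable as a function of the finite pattern pt. *)
pose bad r w := (K <= #|connect (linked w) r|)%N.
pose pt w : {set 'I_m * 'I_m} := [set p : 'I_m * 'I_m | linked w p.1 p.2]%SET.
have mbad r : measurable_fun setT (bad r).
  have mpat (beta : {set 'I_m * 'I_m}) : measurable [set w | pt w = beta].
    rewrite (_ : [set w | _] = \bigcap_(p in [set: 'I_m * 'I_m])
       (informative X U f_in f_out p.1 p.2 @^-1` [set p \in beta])).
      apply: fin_bigcap_measurable; first exact: finite_finset.
      move=> p _; have mt : measurable [set p \in beta] by [].
      have := @measurable_informative _ _ _ P d X Z U _ _ m_in m_out p.1 p.2 measurableT _ mt.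
      by rewrite setTI.
    apply/seteqP; split => w /= h; first by move=> p _ /=; rewrite -h inE.
    by apply/setP => p; rewrite inE; exact: h.
  apply: (measurable_fun_bool true) => //; rewrite setTI.
  rewrite (_ : _ @^-1` _ = \bigcup_(beta in [set beta : {set 'I_m * 'I_m} |
     (K <= #|connect (fun a b => (a, b) \in beta) r|)%N]) [set w | pt w = beta]).
    by apply: fin_bigcup_measurable => // beta _; exact: mpat.
  have cE w : connect (linked w) r =i connect (fun a b => (a, b) \in pt w) r.
    by move=> x; apply: eq_connect => u v; rewrite inE.
  apply/seteqP; split => w /=.
    by move=> h; exists (pt w) => //=; rewrite -(eq_card (cE w)).
  by move=> [beta + wb]; rewrite /= -wb -(eq_card (cE w)).
pose c : R := (2 ^+ m * m%:R)%R.
have -> : (2 ^+ m)%:E * ((K * m)%:R%:E * P Em + m%:R%:E *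
    \sum_(r < m) P (Em `&` [set w | (K <= #|connect (linked w) r|)%N])) =
  \int[P]_(w in Em) (2 ^+ m * (K * m)%:R)%:E +
  \int[P]_(w in Em) (\sum_r c * (bad r w)%:R)%:E.
  rewrite (integral_weighted_indicators P (c := fun=> c) mEm mbad); last first.
    by move=> r; apply: mulr_ge0; [exact: ltW|exact: ler0n].
  rewrite integral_cst// ge0_muleDr; last 2 first.
  - by rewrite mule_ge0// lee_fin.
  - by rewrite mule_ge0 ?lee_fin// sume_ge0.
  rewrite EFinM -muleA; congr (_ + _).
  by rewrite muleA -EFinM ge0_sume_distrr.
have cbad0 r w : (0 <= c * (bad r w)%:R)%R by rewrite !mulr_ge0// ltW.
have mcbad : measurable_fun Em (fun w => (\sum_r c * (bad r w)%:R)%:E).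
  apply/measurable_EFinP; apply: measurable_funTS; apply: measurable_sum => r.
  apply: measurable_funM => //.
  exact: (measurableT_comp measurable_bool_natr (mbad r)).
rewrite -ge0_integralD//; last first.
- by move=> w _; rewrite lee_fin sumr_ge0.
apply: ge0_le_integral => //.
- by move=> w _; rewrite lee_fin sumr_ge0// => z _; rewrite mulr_ge0// sqr_ge0.
- apply/measurable_EFinP; apply: measurable_funTS; apply: measurable_sum => z.
  apply: measurable_funM => //.
  exact: (measurableT_comp measurable_bool_natr (mb z)).
- exact: emeasurable_funD.
move=> w _; rewrite -EFinD lee_fin.
apply: le_trans (_ : \sum_z labelled_sum z w ^+ 2 <= _)%R.
  apply: ler_sum => z _; rewrite /b; case: (boolP (gamma * m%:R <= `|labelled_sum z w|)%R) => [h|_].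
    rewrite mulr1 -[leRHS]real_normK ?num_real// lerXn2r// nnegrE.
    by rewrite mulr_ge0// ltW.
  by rewrite mulr0 sqr_ge0.
apply: le_trans (labelled_second_moment K w) _.
by rewrite natrX mulrDr /c -mulr_sumr mulrA.
Qed.

End second_moment.

(** * The number of points in a box *)

Lemma sum_disjoint_measure_le (d : measure_display) (T : measurableType d) (R : realType)
    (mu : {measure set T -> \bar R}) (F : nat -> set T) (D : set T) :
  (forall n, measurable (F n)) -> trivIset setT F -> measurable D ->
  (forall n, F n `<=` D) -> (\sum_(n <oo) mu (F n) <= mu D)%E.
Proof.
move=> mF tF mD FD; have mU := bigcupT_measurable F mF.
rewrite -measure_semi_bigcup//; apply: le_measure; [exact: mem_set|exact: mem_set|].
by apply: bigcup_sub => n _; exact: FD.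
Qed.

Section box_counts.
Context {R : realType} {dT : measure_display} {T : measurableType dT} (P : probability T R).
Context (d : nat) (d0 : (0 < d)%N) (lambda : R) (lambda0 : 0 < lambda).
Local Notation E := (euclidean R d).
Context (X : nat -> {RV P >-> E}).
Hypothesis poissonX : poisson_process lambda X.
Hypothesis orderX : forall i j w, (i <= j)%N -> supnorm (X i w) <= supnorm (X j w).
Variable n : nat.

Definition box_count m : set T := [set w | first_in (box n) m (X ^~ w)].

Lemma box_lty : (tuple_lebesgue d (@box R d n) < +oo)%E.
Proof. by rewrite volume_box// ltry. Qed.

Lemma box_down i j w : (i <= j)%N -> box n (X j w) -> box n (X i w).
Proof. by move=> ij /box_supnorm h; apply/box_supnorm; exact: le_trans (orderX _ ij) h. Qed.

Lemma measurable_box_count m : measurable (box_count m).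
Proof. by apply: measurable_first_in; exact: measurable_box. Qed.

(** The Poisson law of the color counts, for the coloring with one color. *)
Lemma box_count_law m : P (box_count m) = poisson_prob (lambda * n%:R) m [set m].
Proof.
have mc : coloring (fun _ : E => tt).
  by move=> i; rewrite (_ : _ @^-1` _ = setT)//; apply/seteqP; split => // x _; case: i.
have := poisson_has_colors poissonX (@measurable_box R d n) box_lty mc (nseq m tt) origin.
rewrite (big_pred1 tt); last by case.
rewrite (_ : color_class _ _ _ = box n); last by apply/seteqP; split => [x []//|x].
rewrite volume_box//= count_nseq mul1n => <-; congr (P _); apply/seteqP; split => w.
  move=> h; rewrite /mkset (_ : (fun i => _) = X ^~ w); last first.
    by apply/funext => i; rewrite origin_shift.
  apply/(first_in_colors R (fun _ : E => tt)); first by move=> i j ij; exact: box_down.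
  rewrite size_nseq; split => //; apply: perm_eq_count_mem => -[].
  by rewrite count_map count_nseq mul1n /= (eq_count (a2 := predT))// count_predT size_iota.
rewrite /mkset (_ : (fun i => _) = X ^~ w); last by apply/funext => i; rewrite origin_shift.
move=> /(first_in_colors R (fun _ : E => tt) (nseq m tt) (fun i j ij => @box_down i j w ij))[].
by rewrite size_nseq.
Qed.

Lemma trivIset_box_count : trivIset setT box_count.
Proof.
apply/trivIsetP => m m' _ _ mm'; rewrite -subset0 => w [h h'].
have E1 i : (i < m)%N = (i < m')%N by apply/idP/idP => [/h/h'|/h'/h].
by move: mm' (E1 m) (E1 m'); rewrite !ltnn; case: ltngtP.
Qed.

Lemma box_count_total : P (\bigcup_m box_count m) = 1%E.
Proof.
rewrite measure_semi_bigcup; last 3 first.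
- exact: measurable_box_count.
- exact: trivIset_box_count.
- by apply: bigcupT_measurable => m; exact: measurable_box_count.
rewrite (eq_eseriesr (g := fun m => poisson_prob (lambda * n%:R) m [set m])
  (fun m _ => box_count_law m)).
rewrite -(@probability_setT _ _ _ (poisson_prob (lambda * n%:R) 0)).
rewrite (_ : setT = \bigcup_m [set m]); last by apply/seteqP; split => // m _; exists m.
rewrite measure_semi_bigcup//.
by apply/trivIsetP => i j _ _ ij; rewrite -subset0 => x [-> E']; move: ij; rewrite E' eqxx.
Qed.

(** The ratio of the Poisson weights at m and m.+1 is m.+1 / (lambda n). *)
Lemma box_count_half m : (m.+1%:R <= lambda * n%:R / 2)%R ->
  (P (box_count m) <= (2^-1)%:E * P (box_count m.+1))%E.
Proof.
move=> mL; have m0 : (0 < m.+1%:R :> R) by rewrite ltr0n.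
have L0 : 0 < lambda * n%:R by lra.
rewrite -(@lee_pmul2l _ (lambda * n%:R)%:E)//.
rewrite !box_count_law -(@poisson_prob_succ _ _ m (ltW L0)) muleA -EFinM.
by apply: lee_wpmul2r => //; rewrite lee_fin; lra.
Qed.

(** The weights below M are at most half of the shifted weights, whose sum is at
    most 1. *)
Lemma small_box_counts M : (M%:R <= lambda * n%:R / 2)%R ->
  (\sum_(m <oo) (if (m < M)%N then P (box_count m) else 0) <= (2^-1)%:E)%E.
Proof.
move=> ML; apply: (@le_trans _ _ (\sum_(m <oo) ((2^-1)%:E * P (box_count m.+1))))%E.
  apply: lee_nneseries => [m _ _|m _]; first by case: ifP.
  case: ifP => [mM|_]; last by rewrite mule_ge0// lee_fin invr_ge0.
  by apply: box_count_half; apply: le_trans ML; rewrite ler_nat.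
rewrite nneseriesZl//.
rewrite -[leRHS]mule1; apply: lee_wpmul2l; first by rewrite lee_fin invr_ge0.
rewrite -(@probability_setT _ _ _ P); apply: sum_disjoint_measure_le => //.
- by move=> m; exact: measurable_box_count.
- apply/trivIsetP => i j _ _ ij; move/trivIsetP : trivIset_box_count; apply => //.
Qed.

Lemma box_count_size m w : box_count m w -> box_size X n w = m.
Proof.
move=> h; rewrite /box_size (_ : [set i | _] = [set` seq_fset tt (iota 0 m)]).
  by rewrite set_fsetK size_seq_fset undup_id ?iota_uniq// size_iota.
apply/seteqP; split => i; have := seq_fsetE tt (iota 0 m) i => /= ->; rewrite mem_iota;
  [move/h|by move=> im; apply/h].
by [].
Qed.

(** With infinitely many points in the box, which has probability 0, fset_set
    gives the empty set. *)
Lemma box_count_null w : ~ (\bigcup_m box_count m) w -> box_size X n w = 0%N.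
Proof.
move=> nw; rewrite /box_size /fset_set; case: pselect => [fin|_]; last by rewrite cardfs0.
exfalso; apply: nw.
have [i0 ni0] : exists i, ~~ `[< box n (X i w) >].
  apply/not_existsP => allB; apply: infinite_nat.
  apply: sub_finite_set fin => i _ /=; have := allB i.
  by apply: contra_notP => /asboolPn.
exists (ex_minn (ex_intro (fun i => ~~ `[< box n (X i w) >]) i0 ni0)) => //.
case: ex_minnP => m /asboolPn nBm nmin i; split => [Bi|].
  by rewrite ltnNge; apply/negP => /box_down/(_ Bi).
by rewrite ltnNge => /negP ni; apply: contra_notP ni => /asboolPn; exact: nmin.
Qed.

End box_counts.

(** * The probability of a large overlap *)

Section overlap_probability.
Context {R : realType} {d : nat} (d0 : (0 < d)%N) (lambda : R) (lambda0 : 0 < lambda).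
Local Notation E := (euclidean R d).
Context (f_in f_out : R -> R).
Hypotheses (m_in : measurable_fun [set r : R | 0 <= r] f_in)
  (m_out : measurable_fun [set r : R | 0 <= r] f_out).
Hypothesis f01 : forall r, 0 <= r -> [/\ 0 <= f_in r <= 1, 0 <= f_out r <= 1 & f_out r <= f_in r].
Context {dH : measure_display} {H : measurableType dH} (PH : probability H R).
Context (Y : nat -> {RV PH >-> E}) (e : nat -> nat -> {RV PH >-> bool}).
Hypothesis rcm : palm_rcm lambda (thinned f_in f_out) Y e.
Context {dT : measure_display} {T : measurableType dT} (P : probability T R).
Context (X : nat -> {RV P >-> E}) (Z : nat -> {RV P >-> bool})
  (U : nat -> nat -> {RV P >-> R}).
Hypothesis sbm : block_model lambda X Z U.
Let eY i j : H -> bool := e i j.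

Let orderX i j w : (i <= j)%N -> supnorm (X i w) <= supnorm (X j w).
Proof. by case: sbm => -[_ oX] _ _ _; exact: oX. Qed.

Let poissonX : poisson_process lambda X.
Proof. by case: sbm => -[]. Qed.

Let poissonY : poisson_process lambda Y. Proof. by case: rcm. Qed.

Let meY i j : measurable_fun setT (eY i j). Proof. exact: measurable_funP. Qed.

Variable n : nat.
Local Notation B := (@box R d n).
Local Notation mu := (palm_measure (ltW lambda0) PH).
Local Open Scope ereal_scope.

(** The box contains only one number of points, so that the events for different
    k are disjoint; their union lies in the event that the distinguished point is
    in the box, of measure lambda n. *)
Lemma palm_size_total (C : set H) : measurable C ->
  \sum_(k <oo) mu (palm_size_event Y B k `&` snd @^-1` C) <= (lambda * n%:R)%:E * PH C.
Proof.
move=> mC.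
have mC' : measurable (snd @^-1` C : set (E * H)).
  by rewrite -[X in measurable X]setTI; exact: measurable_snd.
have -> : (lambda * n%:R)%:E * PH C = mu (B `*` C).
  rewrite /palm_measure /mscale /= product_measure1E//; last exact: measurable_box.
  by rewrite EFinM -muleA; congr (_ * (_ * _)); rewrite -(@volume_box R d n d0).
have mS k : measurable (palm_size_event Y B k).
  apply: countable_bigcupT_measurable => [|j]; first exact: countableP.
  by apply: measurable_palm_event; exact: measurable_box.
apply: sum_disjoint_measure_le.
- by move=> k; exact: measurableI.
- apply/trivIsetP => k k' _ _ kk'; rewrite -subset0.
  move=> z [[[j _ [_ [sj jB]]] _] [[j' _ [_ [sj' jB']]] _]].
  have jj' : val j = val j'.
    by apply: (irr_sorted_eq ltn_trans ltnn sj sj') => i; apply/idP/idP => [/jB/jB'|/jB'/jB].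
  by move: kk'; rewrite -(size_tuple j) -(size_tuple j') jj' eqxx.
- by apply: measurableX => //; exact: measurable_box.
- by move=> k z [[j _ [Bz _]] Cz].
Qed.

Lemma informative_cluster_count k K :
  \sum_(r < k.+1) P (box_count X n k.+1 `&`
     [set w | (K <= #|connect (fun a b : 'I_k.+1 => informative X U f_in f_out a b w) r|)%N])
  <= mu (palm_size_event Y B k `&` snd @^-1` cluster_atleast eY K).
Proof.
have [_ [eirr esym elaw]] := rcm.
apply: (cluster_mecke_bound (ltW lambda0) poissonX poissonY (@measurable_box R d n)
  (box_lty d0 n) (fun i j w ij => @box_down _ _ _ _ _ X orderX n i j w ij)
  (measurable_thinned m_in m_out) (thinned01 f01)) => //.
- by move=> i j; exact: (@measurable_informative _ _ _ P d X Z U _ _ m_in m_out i j).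
- exact: (informative_sym sbm).
- exact: informative_irr.
- exact: (informative_law sbm).
Qed.

(** Sum of overlap_bound over the number m >= M of points, each term divided by
    (gamma m)^2 >= gamma^2 M m; the numbers below M are bounded by
    small_box_counts. *)
Lemma overlap_probability_bound (h : @estimator R d) (gamma : R) (K M : nat) :
  (0 < gamma)%R -> (0 < M)%N -> (M%:R <= lambda * n%:R / 2)%R ->
  P [set w | (gamma <= overlap f_in f_out X Z U h n w)%R] <=
  (2^-1)%:E + ((gamma ^+ 2 * M%:R)^-1)%:E *
    (K%:R%:E + (lambda * n%:R)%:E * PH (cluster_atleast eY K)).
Proof.
move=> gamma0 M0 ML; set Ov := [set w | (gamma <= overlap f_in f_out X Z U h n w)%R].
have mC := measurable_cluster_atleast meY K.
pose Bn := box_count X n.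
have mBn m : measurable (Bn m) by exact: measurable_box_count.
have mUBn : measurable (\bigcup_m Bn m) by exact: bigcupT_measurable.
pose S m := Bn m `&` Ov.
have SE m : (0 < m)%N -> S m = overlap_event f_in f_out X Z U B (h m) gamma.
  move=> m0; apply/seteqP; split => w [Bw ov].
    by split => //; move: ov; rewrite /Ov /= /overlap (box_count_size Bw) gtn_eqF.
  by split => //; rewrite /Ov /= /overlap (box_count_size Bw) gtn_eqF.
have mS m : measurable (S m).
  case: m => [|m].
    rewrite (_ : S 0%N = if (gamma <= 1)%R then Bn 0%N else set0); first by case: ifP.
    apply/seteqP; split => w.
      by move=> [Bw]; rewrite /Ov /= /overlap (box_count_size Bw) eqxx => ->.
    case: ifP => // g1 Bw; split => //.
    by rewrite /Ov /= /overlap (box_count_size Bw) eqxx.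
  rewrite SE//.
  by have [] := overlap_bound sbm m_in m_out f01 (@measurable_box R d n) (h m.+1) 0
    gamma0 (ltn0Sn m).
have tB : trivIset setT Bn by exact: trivIset_box_count.
have tS : trivIset setT S.
  apply/trivIsetP => m m' _ _ mm'; rewrite setIACA.
  by rewrite (trivIsetP.1 tB)// set0I.
have PN : P (~` \bigcup_m Bn m) = 0.
  by rewrite probability_setC// (box_count_total d0 poissonX orderX) subee.
have OE : Ov = \bigcup_m S m `|` (if (gamma <= 1)%R then ~` \bigcup_m Bn m else set0).
  have nullO w : ~ (\bigcup_m Bn m) w -> Ov w = ((gamma <= 1)%R : Prop).
    by move=> nw; rewrite /Ov /= /overlap (box_count_null orderX nw) eqxx.
  apply/seteqP; split => w.
    move=> Ow; have [[m _ Bw]|nw] := pselect ((\bigcup_m Bn m) w); first by left; exists m.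
    by right; move: Ow; rewrite nullO// => ->.
  move=> [[m _ []]//|]; case: ifP => // g1 nw.
  by rewrite nullO.
have mN : measurable (if (gamma <= 1)%R then ~` \bigcup_m Bn m else set0).
  by case: ifP => // _; exact: measurableC.
have mUS : measurable (\bigcup_m S m) by exact: bigcupT_measurable.
rewrite OE.
apply: (@le_trans _ _ (P (\bigcup_m S m) + 0)).
  apply: le_trans (measureU2 P mUS mN) _; apply: leeD => //.
  by case: ifP => _; [rewrite [leLHS]PN|rewrite [leLHS]measure0].
rewrite adde0 measure_semi_bigcup//.
(* The number k.+1 of points in the block model corresponds to k points beside
   the distinguished one. *)
pose alpha : R := ((gamma ^+ 2 * M%:R)^-1)%R.
have gM0 : (0 < gamma ^+ 2 * M%:R)%R by rewrite mulr_gt0 ?exprn_gt0 ?ltr0n.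
have alpha0 : (0 < alpha)%R by rewrite invr_gt0.
pose c m := if m is k.+1 then mu (palm_size_event Y B k `&` snd @^-1` cluster_atleast eY K) else 0.
have c0 m : 0 <= c m by rewrite /c; case: m => // m; exact: measure_ge0.
have Kc0 m : 0 <= K%:R%:E * P (Bn m) + c m by rewrite adde_ge0// mule_ge0// lee_fin.
have term m : P (S m) <= (if (m < M)%N then P (Bn m) else 0) +
    alpha%:E * (K%:R%:E * P (Bn m) + c m).
  case: ltnP => mM.
    apply: (@le_trans _ _ (P (Bn m))).
      by apply: le_measure; [exact: mem_set|exact: mem_set|exact: subIsetl].
    by apply: leeDl; rewrite mule_ge0// lee_fin ltW.
  have m0 : (0 < m)%N by exact: leq_trans M0 mM.
  have mR0 : (0 < m%:R :> R)%R by rewrite ltr0n.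
  rewrite add0e SE//.
  have [_ ob] := overlap_bound sbm m_in m_out f01 (@measurable_box R d n) (h m) K gamma0 m0.
  rewrite -(@lee_pmul2l _ (gamma ^+ 2 * M%:R * m%:R)%:E)//; last first.
    by rewrite lte_fin mulr_gt0.
  rewrite [leRHS]muleA -EFinM.
  have -> : (gamma ^+ 2 * M%:R * m%:R * alpha = m%:R)%R.
    by rewrite /alpha mulrAC mulfV ?mul1r// gt_eqF.
  apply: (@le_trans _ _ (((gamma * m%:R) ^+ 2)%:E *
     P (overlap_event f_in f_out X Z U B (h m) gamma))).
    apply: lee_wpmul2r => //; rewrite lee_fin exprMn -mulrA ler_wpM2l ?sqr_ge0//.
    by rewrite expr2 ler_wpM2r ?ler_nat// ltW.
  apply: le_trans ob _.
  rewrite ge0_muleDr//; last by rewrite mule_ge0// lee_fin.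
  rewrite muleA -EFinM -natrM mulnC; apply: leeD => //.
  apply: lee_wpmul2l; first by rewrite lee_fin ltW.
  by rewrite /c; case: m m0 {mM mR0} => // k _; exact: informative_cluster_count.
apply: le_trans (lee_nneseries (fun m _ _ => measure_ge0 P (S m)) (fun m _ => term m)) _.
rewrite nneseriesD//; last 2 first.
- by move=> m _ _; case: ifP.
- by move=> m _ _; rewrite mule_ge0// lee_fin ltW.
apply: leeD; first exact: (small_box_counts d0 poissonX orderX ML).
rewrite nneseriesZl//; apply: lee_wpmul2l; first by rewrite lee_fin ltW.
rewrite nneseriesD//; last by move=> m _ _; rewrite mule_ge0// lee_fin.
apply: leeD.
  rewrite nneseriesZl// -[leRHS]mule1; apply: lee_wpmul2l; first by rewrite lee_fin.
  rewrite -(@probability_setT _ _ _ P); exact: (sum_disjoint_measure_le P mBn tB measurableT).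
apply: le_trans (palm_size_total mC).
rewrite nneseries_recl//= add0e -nneseries_addn//.
by apply: lee_nneseries => // m _; rewrite addn1.
Qed.

End overlap_probability.

Theorem theorem1 (R : realType) (d : nat) (lambda : R) (f_in f_out : R -> R)
    (d_gt0 : (0 < d)%N) (lambda_gt0 : 0 < lambda)
    (sparse : sparse_regime d f_in f_out)
    (dH : measure_display) (H : measurableType dH) (PH : probability H R)
    (Y : nat -> {RV PH >-> euclidean R d}) (e : nat -> nat -> {RV PH >-> bool})
    (rcm : palm_rcm lambda (fun r => f_in r - f_out r) Y e)
    (no_percolation : percolation_probability e = 0%E)
    (dT : measure_display) (T : measurableType dT) (P : probability T R)
    (X : nat -> {RV P >-> euclidean R d}) (Z : nat -> {RV P >-> bool})
    (U : nat -> nat -> {RV P >-> R})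
    (sbm : block_model lambda X Z U) :
  ~ weak_recovery_solvable f_in f_out X Z U.
Proof.
move=> [gamma gamma0 [h hcv]]; have [m_in m_out f01 _ _] := sparse.
have meY i j : measurable_fun setT (e i j) by exact: measurable_funP.
have g20 : 0 < gamma ^+ 2 by rewrite exprn_gt0.
(* The constants are such that K and L p_K each contribute at most 1/8 after
   division by gamma^2 M >= gamma^2 L / 4. *)
have eps0 : 0 < gamma ^+ 2 / 32 by rewrite divr_gt0.
have [K CK] := cluster_atleast_small meY eps0 no_percolation.
have mC := measurable_cluster_atleast meY K.
pose p := fine (PH (cluster_atleast (fun i j => e i j) K)).
have pE : PH (cluster_atleast (fun i j => e i j) K) = p%:E.
  by rewrite fineK// fin_num_measure.
have [N _ hN] : \forall n \near \oo,
    ((3 / 4)%:E < P [set w | (gamma <= overlap f_in f_out X Z U (h n) n w)%R])%E.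
  apply: (hcv [set x | ((3 / 4)%:E < x)%E]); apply: open_nbhs_nbhs; split.
    exact: open_ereal_gt_ereal.
  by rewrite /= lte_fin; lra.
pose L0 := (4 + 32 * K%:R / gamma ^+ 2) / lambda.
have q0 : 0 <= 32 * K%:R / gamma ^+ 2 by rewrite divr_ge0 ?mulr_ge0// ltW.
have L00 : 0 <= L0 by rewrite divr_ge0 ?ltW//; lra.
pose n := maxn N (Num.truncn L0).+1.
pose L := lambda * n%:R.
have LL : 4 + 32 * K%:R / gamma ^+ 2 <= L.
  have /andP[_ h1] := truncn_itv L00.
  have h2 : L0 <= n%:R.
    by apply: le_trans (ltW h1) _; rewrite ler_nat leq_maxr.
  have h3 := ler_wpM2l (ltW lambda_gt0) h2.
  by move: h3; rewrite /L0 mulrC divfK// gt_eqF.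
have KL : 32 * K%:R <= gamma ^+ 2 * L.
  rewrite -ler_pdivrMl// mulrC; lra.
have L2 : 0 <= L / 2 by lra.
pose M := Num.truncn (L / 2).
have /andP[ML LM] := truncn_itv L2.
(* M is the integer part of L / 2, and L >= 4 gives M >= L / 2 - 1 >= L / 4. *)
have L4 : 4 <= L by apply: le_trans LL; rewrite lerDl.
have {}LM : L / 2 < M%:R + 1 by rewrite natr1.
have M4 : L / 4 <= M%:R by lra.
have M0 : (0 < M)%N by rewrite -(ltr0n R); lra.
have := overlap_probability_bound d_gt0 lambda_gt0 m_in m_out f01 rcm sbm
  (h n) K gamma0 M0 ML.
apply/negP; rewrite -ltNge; apply: le_lt_trans (hN n (leq_maxl _ _)).
have pL : p < gamma ^+ 2 / 32 by rewrite -lte_fin -pE.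
rewrite pE.
change ((2^-1 + (gamma ^+ 2 * M%:R)^-1 * (K%:R + lambda * n%:R * p))%:E
  <= (3 / 4)%:E)%E; rewrite lee_fin.
suff : (gamma ^+ 2 * M%:R)^-1 * (K%:R + lambda * n%:R * p) <= 1 / 4 by lra.
have gM : 0 < gamma ^+ 2 * M%:R by rewrite mulr_gt0// ltr0n.
rewrite mulrC ler_pdivrMr// -/L.
have h1 : gamma ^+ 2 * (L / 4) <= gamma ^+ 2 * M%:R by rewrite ler_wpM2l// ltW.
have L0' : 0 <= L by lra.
have h2 : L * p <= L * (gamma ^+ 2 / 32) by rewrite ler_wpM2l// ltW.
nra.
Qed.
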